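(* Let $\tfrac12<s<1$, $q>1$ and $-(n-1)\le a<n(q-1)$. Define $$\theta=\frac{2}{2sq+2-q}\in(0,1),\qquad \sigma=\theta\,\frac{n-1}{2}+(1-\theta)\,\frac{n-1+a}{q}=\frac{2as+2ns-a-2s}{2qs-q+2}.$$ Then there is a constant $C=C(n,s,q,a)$ such that every radial function $u\in H^s_{q,a,rad}(\mathbb{R}^n)$ is equal almost everywhere to a continuous function on $\mathbb{R}^n\setminus\{0\}$, and (for this continuous representative) for all $x\ne 0$ $$|u(x)|\le C\,|x|^{-\sigma}\,[u]_{H^s}^{\theta}\,\|u\|_{L^q_a}^{1-\theta},$$ and consequently (with a possibly different constant $C=C(n,s,q,a)$) $$|u(x)|\le C\,|x|^{-\sigma}\,\|u\|_{H^s_{q,a}}.$$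
   Context: $n$ is the dimension of $\mathbb{R}^n$. The Gagliardo seminorm is $[u]_{H^s}=\left(\frac{C(n,s)}{2}\int_{\mathbb{R}^n}\int_{\mathbb{R}^n}\frac{|u(x)-u(y)|^2}{|x-y|^{n+2s}}\,dx\,dy\right)^{1/2}$ with $C(n,s)=\left(\int_{\mathbb{R}^n}\frac{1-\cos(\zeta_1)}{|\zeta|^{n+2s}}\,d\zeta\right)^{-1}$. The weighted Lebesgue norm is $\|u\|_{L^q_a}=\left(\int_{\mathbb{R}^n}|u(x)|^q|x|^a\,dx\right)^{1/q}$. The space $H^s_{q,a}(\mathbb{R}^n)$ is the completion of $C_0^\infty(\mathbb{R}^n)$ (regarded as a space of functions) with respect to the norm $\|u\|_{H^s_{q,a}}=\left([u]_{H^s}^2+\|u\|_{L^q_a}^2\right)^{1/2}$, and $H^s_{q,a,rad}(\mathbb{R}^n)$ is its subspace of radial functions. *)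

(* Defs.v *)
From HB Require Import structures.
From mathcomp Require Import all_boot all_order all_algebra.
From mathcomp Require Import all_classical all_reals all_analysis.

Set Implicit Arguments.
Unset Strict Implicit.
Unset Printing Implicit Defensive.

Import Order.TTheory GRing.Theory Num.Theory.
Import numFieldNormedType.Exports.

Local Open Scope classical_set_scope.
Local Open Scope ring_scope.

(* The product sigma-algebra, generated by the coordinates as the library does
   for [n.-tuple T]; on R^n it is the Borel sigma-algebra. *)
Section measurable_rV.
Context {R : realType}.
Variable n : nat.

Let coord : 'I_n -> 'rV[R]_n -> R := fun i x => x ord0 i.

Let rV_set0 : g_sigma_preimage coord set0.
Proof. exact: sigma_algebra0. Qed.

Let rV_setC A : g_sigma_preimage coord A -> g_sigma_preimage coord (~` A).
Proof. exact: sigma_algebraC. Qed.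

Let rV_bigcup (F : _^nat) : (forall i, g_sigma_preimage coord (F i)) ->
  g_sigma_preimage coord (\bigcup_i (F i)).
Proof. exact: sigma_algebra_bigcup. Qed.

HB.instance Definition _ := @isMeasurable.Build default_measure_display
  'rV[R]_n (g_sigma_preimage coord) rV_set0 rV_setC rV_bigcup.

End measurable_rV.

Section measurable_rV_lemmas.
Context {R : realType}.

Lemma measurable_coord n (i : 'I_n) :
  measurable_fun [set: 'rV[R]_n] (fun x => x ord0 i).
Proof.
move=> _ Y mY; rewrite setTI; apply: sub_sigma_algebra => /=.
rewrite -bigcup_seq/=; exists i => /=; first by rewrite mem_index_enum.
by exists Y => //; rewrite setTI.
Qed.

Lemma measurable_fun_rVP d (T : measurableType d) n (f : T -> 'rV[R]_n) :
  (forall i, measurable_fun [set: T] (fun x => f x ord0 i)) ->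
  measurable_fun [set: T] f.
Proof.
move=> mf.
suff prefS : g_sigma_preimage (fun i x => f x ord0 i) `<=` measurable.
  move=> _ A mA; apply: prefS.
  by rewrite (g_sigma_preimage_comp (fun i (x : 'rV[R]_n) => x ord0 i)); exists A.
apply: smallest_sub; first exact: sigma_algebra_measurable.
case: n => [|n] in f mf *; first by rewrite big_ord0.
rewrite -bigcup_mkord_ord; apply: bigcup_sub => i Ii.
by move=> A [B mB <-]; exact: mf.
Qed.

Definition rV_cons n (p : measurableTypeR R * 'rV[R]_n) : 'rV[R]_n.+1 :=
  row_mx (const_mx p.1 : 'rV_1) p.2.

Definition rV_uncons n (x : 'rV[R]_n.+1) : measurableTypeR R * 'rV[R]_n :=
  (x ord0 ord0, \row_i x ord0 (lift ord0 i)).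

Lemma rV_cons0 n (p : measurableTypeR R * 'rV[R]_n) : rV_cons p ord0 ord0 = p.1.
Proof.
by rewrite mxE; case: splitP => //= j _; rewrite mxE.
Qed.

Lemma rV_consS n (p : measurableTypeR R * 'rV[R]_n) i : rV_cons p ord0 (lift ord0 i) = p.2 ord0 i.
Proof.
rewrite mxE; case: splitP => [[[]]//|k /= /eqP].
by rewrite /bump/= !add1n eqSS => /eqP ik; congr (p.2 _ _); exact: val_inj.
Qed.

Lemma rV_consK n : cancel (@rV_cons n) (@rV_uncons n).
Proof.
move=> [t x]; rewrite /rV_uncons rV_cons0; congr pair.
by apply/rowP => i; rewrite mxE rV_consS.
Qed.

Lemma measurable_rV_cons n : measurable_fun [set: measurableTypeR R * 'rV[R]_n] (@rV_cons n).
Proof.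
apply: measurable_fun_rVP => i; case: (unliftP ord0 i) => [j|] ->.
- under eq_fun do rewrite rV_consS.
  apply: (measurableT_comp (measurable_coord j)); exact: measurable_snd.
- under eq_fun do rewrite rV_cons0.
  exact: measurable_fst.
Qed.

Lemma measurable_rV_uncons n :
  measurable_fun [set: 'rV[R]_n.+1] (@rV_uncons n).
Proof.
apply: measurable_fun_pair; first exact: measurable_coord.
apply: measurable_fun_rVP => i; under eq_fun do rewrite mxE.
exact: measurable_coord.
Qed.

End measurable_rV_lemmas.

Section lebesgue_measure_rV.
Context {R : realType}.

Section step.
Variables (n : nat) (mu : {sigma_finite_measure set 'rV[R]_n -> \bar R}).

Definition lebesgue_step : set 'rV[R]_n.+1 -> \bar R :=
  pushforward (lebesgue_measure \x mu)%E (@rV_cons R n).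

Let mcons A : measurable A -> measurable (@rV_cons R n @^-1` A).
Proof.
by move=> mA; rewrite -[X in measurable X]setTI; exact: measurable_rV_cons.
Qed.

Let lebesgue_step0 : lebesgue_step set0 = 0%E.
Proof. by rewrite /lebesgue_step /pushforward preimage_set0 measure0. Qed.

Let lebesgue_step_ge0 A : (0 <= lebesgue_step A)%E.
Proof. by rewrite /lebesgue_step /pushforward; exact: measure_ge0. Qed.

Let lebesgue_step_sigma_additive : semi_sigma_additive lebesgue_step.
Proof.
move=> F mF tF mUF; rewrite /lebesgue_step /pushforward preimage_bigcup.
apply: measure_semi_sigma_additive.
- by move=> k; exact: mcons.
- apply/trivIsetP => /= i j _ _ ij; rewrite -preimage_setI.
  by move/trivIsetP : tF => /(_ _ _ _ _ ij) ->//; rewrite preimage_set0.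
- by rewrite -preimage_bigcup; exact: mcons.
Qed.

HB.instance Definition _ := isMeasure.Build _ _ _ lebesgue_step
  lebesgue_step0 lebesgue_step_ge0 lebesgue_step_sigma_additive.

Let lebesgue_step_sigma_finite : sigma_finite setT lebesgue_step.
Proof.
have /sigma_finiteP[F [TF ndF Foo]] :=
  sigma_finiteT (@lebesgue_measure R : {sigma_finite_measure set _ -> \bar R}).
have /sigma_finiteP[G [TG ndG Goo]] := sigma_finiteT mu.
exists (fun k => @rV_uncons R n @^-1` (F k `*` G k)).
  rewrite -preimage_bigcup (_ : \bigcup_k _ = setT) ?preimage_setT//.
  apply/seteqP; split => // -[t x] _.
  have [i _ Fit] : (\bigcup_i F i) t by rewrite -TF.
  have [j _ Gjx] : (\bigcup_j G j) x by rewrite -TG.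
  exists (maxn i j) => //; split => /=.
    by move: t Fit; exact/subsetPset/ndF/leq_maxl.
  by move: x Gjx; exact/subsetPset/ndG/leq_maxr.
move=> k; have [mF Fk] := Foo k; have [mG Gk] := Goo k; split.
  rewrite -[X in measurable X]setTI; apply: measurable_rV_uncons => //.
  exact: measurableX.
rewrite /lebesgue_step /pushforward -comp_preimage.
rewrite (_ : _ \o _ = id); last by rewrite funeqE => p; exact: rV_consK.
by rewrite preimage_id product_measure1E// lte_mul_pinfty// ge0_fin_numE.
Qed.

HB.instance Definition _ := Measure_isSigmaFinite.Build _ _ _ lebesgue_step
  lebesgue_step_sigma_finite.
End step.

(* R^0 is a point, of mass 1; R^(n+1) is R x R^n. *)
Fixpoint lebesgue_rV n : {sigma_finite_measure set 'rV[R]_n -> \bar R} :=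
  match n with
  | 0 => \d_(0 : 'rV[R]_0)
  | m.+1 => lebesgue_step (lebesgue_rV m)
  end.

Lemma lebesgue_rV_box n (A : 'I_n -> set R) :
  (forall i, measurable (A i)) ->
  lebesgue_rV n [set x | forall i, A i (x ord0 i)] =
  (\prod_(i < n) lebesgue_measure (A i))%E.
Proof.
elim: n A => [|n ih] A mA /=.
  by rewrite big_ord0 diracE mem_set//; case.
rewrite big_ord_recl -ih; last by move=> i; exact: mA.
have mB : measurable [set x : 'rV[R]_n | forall i, A (lift ord0 i) (x ord0 i)].
  rewrite (_ : [set x | _] =
      \bigcap_(i in [set: 'I_n])
        ((fun x : 'rV[R]_n => x ord0 i) @^-1` A (lift ord0 i))).
    apply: fin_bigcap_measurable; first exact: finite_finset.
    move=> i _; rewrite -[X in measurable X]setTI.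
    by apply: measurable_coord => //; exact: mA.
  by apply/seteqP; split => x /= Bx i; [move=> _|]; exact: Bx.
rewrite -product_measure1E//; last exact: mA.
rewrite /lebesgue_step /pushforward; congr (product_measure1 _ _ _).
apply/seteqP; split => -[t x] /=.
  move=> Ax; split; first by have := Ax ord0; rewrite rV_cons0.
  by move=> i; have := Ax (lift ord0 i); rewrite rV_consS.
move=> [At Ax] i; case: (unliftP ord0 i) => [j|] ->.
  by rewrite rV_consS.
by rewrite rV_cons0.
Qed.

End lebesgue_measure_rV.

Section defs.
Context {R : realType}.

(* First coordinate; the value in dimension 0 is irrelevant. *)
Definition coord1 n : 'rV[R]_n -> R :=
  match n with
  | 0 => fun=> 0
  | m.+1 => fun x => x ord0 ord0
  end.

Section fixed_dim.
Variable n : nat.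
Implicit Types (u v phi : 'rV[R]_n -> R) (x y : 'rV[R]_n).

(* The library's norm on ['rV_n] is the sup norm. *)
Definition enorm x : R := Num.sqrt (\sum_(i < n) x ord0 i ^+ 2).

(* C^k, by iterated partial derivatives *)
Fixpoint Ck (k : nat) u : Prop :=
  continuous u /\
  match k with
  | 0 => True
  | m.+1 => forall i : 'I_n,
      (forall x, derivable u x (delta_mx ord0 i)) /\
      Ck m (fun x => 'D_(delta_mx ord0 i) u x)
  end.

Definition smooth u : Prop := forall k, Ck k u.

Definition C0infty : set ('rV[R]_n -> R) :=
  [set phi | smooth phi /\ compact (closure [set x | phi x != 0])].

Local Notation mu := (@lebesgue_rV R n).

Definition fracC (s : R) : R :=
  (fine (\int[mu]_z ((1 - cos (coord1 z)) / enorm z `^ (n%:R + 2 * s))%:E))^-1.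

Local Open Scope ereal_scope.

Definition gagliardo (s : R) u : \bar R :=
  ((fracC s / 2)%:E *
   \int[mu]_y \int[mu]_x
     (`|u x - u y| ^+ 2 / enorm (x - y) `^ (n%:R + 2 * s))%:E) `^ 2^-1.

Definition wLnorm (q a : R) u : \bar R :=
  (\int[mu]_x (`|u x| `^ q * enorm x `^ a)%:E) `^ q^-1.

Definition Hnorm (s q a : R) u : \bar R :=
  (gagliardo s u ^+ 2 + wLnorm q a u ^+ 2) `^ 2^-1.

(* The completion of C0infty realized as a space of functions (modulo equality
   a.e.): the closure of C0infty in the measurable functions, for Hnorm. *)
Definition Hspace (s q a : R) : set ('rV[R]_n -> R) :=
  [set u : 'rV[R]_n -> R | measurable_fun setT u /\
    exists phi : nat -> 'rV[R]_n -> R, (forall k, C0infty (phi k)) /\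
      Hnorm s q a (fun x => u x - phi k x)%R @[k --> \oo] --> 0].

(* Elements of [Hspace] being classes modulo equality a.e., so is radiality. *)
Definition radial u : Prop :=
  exists f : R -> R, {ae mu, forall x, u x = f (enorm x)}.

Definition Hspace_rad (s q a : R) : set ('rV[R]_n -> R) :=
  Hspace s q a `&` [set u | radial u].

End fixed_dim.

Definition theta (s q : R) : R := 2 / (2 * s * q + 2 - q).

Definition sigma (n : nat) (s q a : R) : R :=
  theta s q * ((n%:R - 1) / 2) + (1 - theta s q) * ((n%:R - 1 + a) / q).

End defs.

(* Main.v *)
(** For a radial function u(x) = f(|x|), the average of |u - u(y)|^2 over an
    annulus equals its average over the part of the annulus lying in a thin cone
    around y, where |x - y| is comparable to the thickness d of the annulus.
    Hence the average is at most C d^(2s) g(y), g being the inner Gagliardo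
    integral, and comparing two points through a common annulus gives
        |u(y1) - u(y2)|^2 <= C d^(2s) (g(y1) + g(y2))
    as soon as r <= |y1|, |y2| <= r + d.  Choosing in each annulus a point where
    g is at most its average, and going through dyadic d (this is where s > 1/2
    enters), one obtains a profile w, equal to f almost everywhere, with
        |w(r) - w(r')| <= C r^(-(n-1)/2) [u] |r - r'|^(s-1/2)     (r < r').
    The weighted norm bounds |w| at some point of [r + d/2, r + d] by
    C (d r^(n-1+a))^(-1/q) |u|, since n - 1 + a >= 0; optimizing over d > 0
    yields the inequality.  Elements of the completion have finite seminorm and
    weighted norm because smooth compactly supported functions do. *)
From HB Require Import structures.
Require Import Defs.
From mathcomp Require Import all_boot all_order all_algebra.
From mathcomp Require Import all_classical all_reals all_analysis.
From mathcomp Require Import measurable_realfun ring lra.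

Set Implicit Arguments.
Unset Strict Implicit.
Unset Printing Implicit Defensive.

Import Order.TTheory GRing.Theory Num.Theory.
Import numFieldNormedType.Exports.

Local Open Scope classical_set_scope.
Local Open Scope ring_scope.

(** * Lebesgue measure and the Euclidean norm *)

(** Polar coordinates are replaced by a comparison of measures on the line: the distributions of |x|
    under Lebesgue measure and under its restriction to a cone both give balls of radius r a mass
    proportional to r^n, hence are proportional to each other. The exponent s - 1/2 comes from a
    volume count. An annulus of radius r and thickness d has measure at least of order d r^(n-1), so
    the average of g over it is at most of order D / (d r^(n-1)), where D is the integral of g. The
    pointwise inequality then bounds squared differences by a multiple of d^(2s-1) D r^(-(n-1)),
    whose roots are summable over dyadic d exactly when s > 1/2. Two gaps separate the definitions
    from this argument. Radiality provides some f, possibly not measurable, so a measurable one must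
    be built. And the seminorms take values in [0, +oo], while C(n,s) is the inverse of a finite
    part that is 0 when the integral diverges; so C(n,s) > 0 and the finiteness of both quantities
    for u are proved before any computation with real numbers. *)

Section affine_change_of_variables.
Context {R : realType}.

(** The pushforward scaled by [r] has the right value on half-open intervals, and these determine
    Lebesgue measure. *)
Lemma lebesgue_measure_affine (r b : R) (A : set R) : 0 < r -> measurable A ->
  lebesgue_measure A =
  (r%:E * lebesgue_measure ((fun x => r * x + b)%R @^-1` A))%E.
Proof.
move=> r0 mA.
pose f : measurableTypeR R -> measurableTypeR R := fun x => r * x + b.
have mf : measurable_fun setT f.
  by apply: measurable_funD => //; exact: measurable_funM.
pose fmix := isMeasurableFun.Build _ _ _ _ _ mf.
pose fP : {mfun _ >-> _} := HB.pack f fmix.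
pose rr : {nonneg R} := NngNum (ltW r0).
rewrite (lebesgue_measure_unique (mu := mscale rr (pushforward lebesgue_measure fP)))//.
move=> _ [[x y]] _ <-.
rewrite -[RHS]/(r%:E * lebesgue_measure (f @^-1` `]x, y]))%E.
rewrite [X in (_ * lebesgue_measure X)%E](_ : _ =
    `]r^-1 * (x - b), r^-1 * (y - b)]%classic); last first.
  apply/seteqP; split => t /=; rewrite !in_itv/= /f => /andP[h1 h2]; apply/andP; split.
  - by rewrite mulrC ltr_pdivrMr// ltrBlDr mulrC.
  - by rewrite mulrC ler_pdivlMr// lerBrDr mulrC.
  - by move: h1; rewrite mulrC ltr_pdivrMr// ltrBlDr mulrC.
  - by move: h2; rewrite mulrC ler_pdivlMr// lerBrDr mulrC.
rewrite !lebesgue_measure_itv/= !lte_fin ltr_pM2l ?invr_gt0// ltrD2r.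
case: ifPn => xy; last by rewrite mule0.
by rewrite !EFinN -!EFinB -EFinM; congr EFin; field; rewrite gt_eqF.
Qed.

Lemma measurable_affine n (r : R) (b : 'rV[R]_n) :
  measurable_fun setT (fun x : 'rV[R]_n => r *: x + b).
Proof.
apply: measurable_fun_rVP => i; under eq_fun do rewrite !mxE.
by apply: measurable_funD => //; apply: measurable_funM => //; exact: measurable_coord.
Qed.

(** Induction on the dimension: on product sets the scaled pushforward splits into a one-dimensional
    factor and the inductive one, and a product measure is determined by its values there. *)
Lemma lebesgue_rV_affine n (r : R) (b : 'rV[R]_n) (A : set 'rV[R]_n) :
  0 < r -> measurable A ->
  lebesgue_rV n A =
  ((r ^+ n)%:E * lebesgue_rV n ((fun x => r *: x + b)%R @^-1` A))%E.
Proof.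
move=> r0; elim: n b A => [|n ih] b A mA /=.
  rewrite expr0 mul1e; congr (\d_ _ _).
  apply/funext => x/=; rewrite /preimage/=.
  by congr A; apply/rowP; case.
pose b0 := b ord0 ord0.
pose b' := \row_i b ord0 (lift ord0 i).
pose f : measurableTypeR R * 'rV[R]_n -> measurableTypeR R * 'rV[R]_n :=
  fun p => (r * p.1 + b0, r *: p.2 + b').
have mf : measurable_fun setT f.
  apply: measurable_fun_pair => /=.
    apply: measurable_funD => //; apply: measurable_funM => //.
  by apply: (measurableT_comp (measurable_affine r b')); exact: measurable_snd.
pose fmix := isMeasurableFun.Build _ _ _ _ _ mf.
pose fP : {mfun _ >-> _} := HB.pack f fmix.
pose rr : {nonneg R} := NngNum (exprn_ge0 n.+1 (ltW r0)).
rewrite /lebesgue_step /pushforward.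
have mcA : measurable (@rV_cons R n @^-1` A).
  by rewrite -[X in measurable X]setTI; exact: measurable_rV_cons.
rewrite (product_measure_unique (m' := mscale rr
  (pushforward (lebesgue_measure \x lebesgue_rV n)%E fP)))//.
  rewrite /mscale/= /pushforward; congr (_ * product_measure1 _ _ _)%E.
  apply/seteqP; split => -[t x]; rewrite /preimage/=;
    (have -> : rV_cons (f (t, x)) = r *: rV_cons (t, x) + b; last by []);
  apply/rowP => i; rewrite [RHS]mxE [in RHS]mxE;
  case: (unliftP ord0 i) => [j|] -> ; rewrite ?rV_consS ?rV_cons0 /f/= ?mxE//;
  by [].
move=> X Y mX mY.
rewrite -[LHS]/((r ^+ n.+1)%:E * product_measure1 lebesgue_measure
  (lebesgue_rV n) (((fun x => r * x + b0)%R @^-1` X) `*`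
    ((fun x => r *: x + b')%R @^-1` Y)))%E.
rewrite product_measure1E//; last 2 first.
- rewrite -[X in measurable X]setTI.
  have : measurable_fun [set: measurableTypeR R] (fun x : measurableTypeR R => r * x + b0
    : measurableTypeR R).
    by apply: measurable_funD => //; exact: measurable_funM.
  exact.
- by rewrite -[X in measurable X]setTI; exact: measurable_affine.
rewrite exprS EFinM muleACA.
by congr (_ * _)%E; [exact/esym/lebesgue_measure_affine|exact/esym/ih].
Qed.

End affine_change_of_variables.

Section euclidean_norm.
Context {R : realType}.
Variable n : nat.
Implicit Types (x y z : 'rV[R]_n).

Lemma enorm_ge0 x : 0 <= enorm x.
Proof. exact: sqrtr_ge0. Qed.

Lemma enorm_sqr x : enorm x ^+ 2 = \sum_(i < n) x ord0 i ^+ 2.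
Proof. by rewrite sqr_sqrtr// sumr_ge0// => i _; exact: sqr_ge0. Qed.

Lemma enorm_coord x i : `|x ord0 i| <= enorm x.
Proof.
rewrite -(@ler_pXn2r _ 2) ?nnegrE ?enorm_ge0// enorm_sqr real_normK ?num_real//.
by rewrite (bigD1 i)//= lerDl sumr_ge0// => j _; exact: sqr_ge0.
Qed.

Lemma enorm_le_sum x : enorm x <= \sum_(i < n) `|x ord0 i|.
Proof.
have s0 : 0 <= \sum_(i < n) `|x ord0 i| by apply: sumr_ge0.
rewrite -(@ler_pXn2r _ 2) ?nnegrE ?enorm_ge0// enorm_sqr.
rewrite [leRHS]expr2 mulr_suml; apply: ler_sum => i _.
rewrite -[leLHS]real_normK ?num_real// expr2 ler_wpM2l//.
by rewrite (bigD1 i)//= lerDl sumr_ge0.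
Qed.

Lemma enormZ (t : R) x : enorm (t *: x) = `|t| * enorm x.
Proof.
apply: (@pexpIrn _ 2); rewrite ?nnegrE ?mulr_ge0 ?enorm_ge0//.
rewrite exprMn !enorm_sqr real_normK ?num_real// mulr_sumr.
by apply: eq_bigr => i _; rewrite mxE exprMn.
Qed.

Lemma enormN x : enorm (- x) = enorm x.
Proof. by rewrite -scaleN1r enormZ normrN1 mul1r. Qed.

Lemma enorm0 : enorm (0 : 'rV[R]_n) = 0.
Proof. by rewrite -(scale0r 0) enormZ normr0 mul0r. Qed.

Lemma enorm_eq0 x : (enorm x == 0) = (x == 0).
Proof.
apply/idP/eqP => [/eqP x0|->]; last by rewrite enorm0.
apply/rowP => i; rewrite mxE; apply/eqP; rewrite -normr_le0 -x0.
exact: enorm_coord.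
Qed.

Lemma enorm_gt0 x : (0 < enorm x) = (x != 0).
Proof. by rewrite lt0r enorm_eq0 enorm_ge0 andbT. Qed.

Lemma ler_enormD x y : enorm (x + y) <= enorm x + enorm y.
Proof.
have [->|x0] := eqVneq x 0; first by rewrite add0r enorm0 add0r.
have [->|y0] := eqVneq y 0; first by rewrite addr0 enorm0 addr0.
rewrite -enorm_gt0 in x0; rewrite -enorm_gt0 in y0.
rewrite -(@ler_pXn2r _ 2) ?nnegrE ?addr_ge0 ?enorm_ge0// enorm_sqr.
have -> : \sum_(i < n) (x + y) ord0 i ^+ 2 = enorm x ^+ 2 + enorm y ^+ 2 +
    2 * \sum_(i < n) x ord0 i * y ord0 i.
  rewrite !enorm_sqr mulr_sumr -!big_split/=; apply: eq_bigr => i _.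
  by rewrite mxE; ring.
rewrite sqrrD; suff : \sum_(i < n) x ord0 i * y ord0 i <= enorm x * enorm y by lra.
(* Cauchy-Schwarz through Young's inequality, with the weight |y|/|x| for which the right-hand side
   sums to exactly |x||y|. *)
have H : \sum_(i < n) x ord0 i * y ord0 i <= \sum_(i < n) (enorm y / enorm x *
   x ord0 i ^+ 2 + enorm x / enorm y * y ord0 i ^+ 2) / 2.
  apply: ler_sum => i _.
  have := sqr_ge0 (enorm y * x ord0 i - enorm x * y ord0 i) => h.
  rewrite -subr_ge0.
  have -> : (enorm y / enorm x * x ord0 i ^+ 2 +
    enorm x / enorm y * y ord0 i ^+ 2) / 2 - x ord0 i * y ord0 i =
    (enorm y * x ord0 i - enorm x * y ord0 i) ^+ 2 / (2 * enorm x * enorm y).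
    by field; rewrite !gt_eqF.
  by rewrite divr_ge0// !mulr_ge0// enorm_ge0.
apply: (le_trans H); rewrite -mulr_suml big_split/= -!mulr_sumr -!enorm_sqr.
by rewrite le_eqVlt; apply/orP; left; apply/eqP; field; rewrite !gt_eqF.
Qed.

Lemma ler_dist_enorm x y : `|enorm x - enorm y| <= enorm (x - y).
Proof.
have h1 := ler_enormD (x - y) y; have h2 := ler_enormD (y - x) x.
rewrite !subrK in h1 h2; rewrite -(enormN (y - x)) opprB in h2.
by rewrite ler_norml; apply/andP; split; lra.
Qed.

Lemma enorm_le_mx_norm x : enorm x <= n%:R * `|x|.
Proof.
apply: le_trans (enorm_le_sum _) _.
rewrite -[X in X%:R]card_ord mulr_natl -sumr_const; apply: ler_sum => i _.
by rewrite /Num.norm/= mx_normrE; apply: le_bigmax (fun ij => `|x ij.1 ij.2|) (ord0, i).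
Qed.

Lemma measurable_enorm : measurable_fun setT (@enorm R n).
Proof.
have H : measurable_fun setT (fun x : 'rV[R]_n => \sum_(i < n) x ord0 i ^+ 2).
  apply: measurable_sum => i; apply: measurable_funX; exact: measurable_coord.
have := @measurable_powR R 2^-1.
move=> /measurableT_comp /(_ H); apply: eq_measurable_fun => x _ /=.
by rewrite powR12_sqrt// sumr_ge0// => i _; exact: sqr_ge0.
Qed.

HB.instance Definition _ :=
  isMeasurableFun.Build _ _ _ _ (@enorm R n) measurable_enorm.

Lemma continuous_enorm : continuous (@enorm R n).
Proof.
move=> x; apply/(@cvgrPdist_lt _ _ _ (nbhs x) (nbhs_filter x)) => e e0.
(* The topology is that of the sup norm, which controls [enorm] up to the factor n; n + 1 keeps the
   divisor positive also for n = 0. *)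
have n0 : 0 < n%:R + 1 :> R by rewrite ltr_wpDl.
have : nbhs x (ball x (e / (n%:R + 1))) by apply: nbhsx_ballx; exact: divr_gt0.
apply: filterS => y; rewrite -ball_normE /ball_/= => xy.
apply: le_lt_trans (ler_dist_enorm _ _) _.
apply: le_lt_trans (enorm_le_mx_norm _) _.
apply: (@le_lt_trans _ _ ((n%:R + 1) * `|x - y|)).
  by rewrite ler_wpM2r// lerDl.
by rewrite mulrC -ltr_pdivlMr.
Qed.

End euclidean_norm.

Section pair_measurability.
Context {R : realType}.
Variable n : nat.

Lemma measurable_sub_pair :
  measurable_fun setT (fun p : 'rV[R]_n * 'rV[R]_n => p.1 - p.2).
Proof.
apply: measurable_fun_rVP => i; under eq_fun do rewrite !mxE.
apply: measurable_funB.
  exact: (measurableT_comp (measurable_coord i) measurable_fst).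
exact: (measurableT_comp (measurable_coord i) measurable_snd).
Qed.

Lemma measurable_weighted (u : 'rV[R]_n -> R) (q a : R) : measurable_fun setT u ->
  measurable_fun setT (fun x => (`|u x| `^ q * enorm x `^ a)%:E).
Proof.
move=> mu_; apply/measurable_EFinP; apply: measurable_funM.
  apply: (measurableT_comp (@measurable_powR R _)).
  exact: measurableT_comp.
exact: (measurableT_comp (@measurable_powR R _) (@measurable_enorm R n)).
Qed.

End pair_measurability.

Section integral_affine.
Context {R : realType}.
Local Open Scope ereal_scope.

Lemma ge0_integral_affine n (r : R) (b : 'rV[R]_n) (h : 'rV[R]_n -> \bar R) :
  (0 < r)%R -> measurable_fun setT h -> (forall x, 0 <= h x) ->
  \int[lebesgue_rV n]_x h x =
  (r ^+ n)%:E * \int[lebesgue_rV n]_x h (r *: x + b)%R.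
Proof.
move=> r0 mh h0.
pose f := fun x : 'rV[R]_n => (r *: x + b)%R.
pose fmix := isMeasurableFun.Build _ _ _ _ _ (measurable_affine r b : measurable_fun setT f).
pose fP : {mfun _ >-> _} := HB.pack f fmix.
pose rr : {nonneg R} := NngNum (exprn_ge0 n (ltW r0)).
rewrite (eq_measure_integral (mscale rr (pushforward (lebesgue_rV n) fP)))//.
  rewrite ge0_integral_mscale//=; congr (_ * _).
  by rewrite ge0_integral_pushforward//; exact: measurable_affine.
by move=> A mA _; exact: (lebesgue_rV_affine b r0 mA).
Qed.

End integral_affine.

(** * Annuli and cones *)

Section cube.
Context {R : realType}.
Variable n : nat.
Local Notation mu := (@lebesgue_rV R n).

Definition cube (c : 'rV[R]_n) (r : R) : set 'rV[R]_n :=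
  [set x | forall i, `](c ord0 i - r), (c ord0 i + r)[%classic (x ord0 i)].

Lemma measurable_cube c r : measurable (cube c r).
Proof.
rewrite (_ : cube c r = \bigcap_(i in [set: 'I_n])
    ((fun x : 'rV[R]_n => x ord0 i) @^-1`
      `](c ord0 i - r), (c ord0 i + r)[%classic)); last first.
  by apply/seteqP; split => x /= xc i; [move=> _|]; exact: xc.
apply: fin_bigcap_measurable; first exact: finite_finset.
move=> i _; rewrite -[X in measurable X]setTI.
by apply: measurable_coord => //; exact: measurable_itv.
Qed.

Lemma lebesgue_rV_cube c r : 0 < r -> mu (cube c r) = ((2 * r) ^+ n)%:E.
Proof.
move=> r0; rewrite /cube.
rewrite (lebesgue_rV_box (A := fun i => `](c ord0 i - r), (c ord0 i + r)[%classic)).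
  rewrite (eq_bigr (fun=> (2 * r)%:E)); first by rewrite prodEFin prodr_const card_ord.
  move=> i _; rewrite lebesgue_measure_itv/= lte_fin.
  rewrite ifT; last by lra.
  by rewrite -EFinB; congr EFin; ring.
by move=> i; exact: measurable_itv.
Qed.

Lemma cube_enorm c r x : cube c r x -> enorm (x - c) <= n%:R * r.
Proof.
move=> xc; apply: le_trans (enorm_le_sum _) _.
rewrite -[X in X%:R]card_ord mulr_natl -sumr_const; apply: ler_sum => i _.
have := xc i; rewrite /= in_itv/= !mxE => /andP[h1 h2].
by rewrite ler_norml; apply/andP; split; lra.
Qed.

Lemma enorm_cube c r x : enorm (x - c) < r -> cube c r x.
Proof.
move=> xc i; have := le_lt_trans (enorm_coord (x - c) i) xc.
rewrite !mxE ltr_norml => /andP[h1 h2].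
by rewrite /= in_itv/=; apply/andP; split; lra.
Qed.

End cube.

Section annuli.
Context {R : realType}.
Variable n : nat.
Hypothesis n_gt0 : (0 < n)%N.
Local Notation mu := (@lebesgue_rV R n).

Definition annulus (a b : R) : set 'rV[R]_n := [set x | a <= enorm x < b].

Definition cone (G : set 'rV[R]_n) :=
  forall (t : R) x, 0 < t -> G (t *: x) <-> G x.

Lemma measurable_enorm_preimage (A : set R) :
  measurable A -> measurable ((@enorm R n) @^-1` A).
Proof.
by move=> mA; rewrite -[X in measurable X]setTI; exact: measurable_enorm.
Qed.

Lemma annulusE a b : annulus a b = (@enorm R n) @^-1` `[a, b[%classic.
Proof. by apply/seteqP; split => x; rewrite /annulus/= in_itv. Qed.

Lemma measurable_annulus a b : measurable (annulus a b).
Proof. by rewrite annulusE; apply: measurable_enorm_preimage; exact: measurable_itv. Qed.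

Lemma enorm_ray r : (@enorm R n) @^-1` `]-oo, r[%classic = [set x | enorm x < r].
Proof. by apply/seteqP; split => x; rewrite /= in_itv. Qed.

Lemma measurable_ball_enorm r : measurable [set x : 'rV[R]_n | enorm x < r].
Proof. by rewrite -enorm_ray; apply: measurable_enorm_preimage; exact: measurable_itv. Qed.

(** Dilation by [r] preserves [G] and maps the unit ball onto the ball of radius [r]. *)
Lemma lebesgue_rV_cone_ball G r : measurable G -> cone G -> 0 < r ->
  mu (G `&` [set x | enorm x < r]) =
  ((r ^+ n)%:E * mu (G `&` [set x | (enorm x < 1)%R]))%E.
Proof.
move=> mG cG r0; rewrite (lebesgue_rV_affine 0 r0); last first.
  by apply: measurableI => //; exact: measurable_ball_enorm.
congr (_ * mu _)%E; apply/seteqP; split => x /=;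
  rewrite addr0 enormZ gtr0_norm// -ltr_pdivlMl// mulVf ?gt_eqF//;
  by move=> [Gx ?]; split => //; apply/(cG r).
Qed.

Lemma ball_lty r : (mu [set x | (enorm x < r)%R] < +oo)%E.
Proof.
have r0 : 0 < `|r| + 1 by rewrite ltr_wpDl.
apply: (@le_lt_trans _ _ (mu (cube 0 (`|r| + 1)))).
  apply: le_measure; rewrite ?inE.
  - exact: measurable_ball_enorm.
  - exact: measurable_cube.
  - move=> x /= xr; apply: enorm_cube; rewrite subr0.
    by apply: (lt_le_trans xr); rewrite (le_trans (ler_norm r))// lerDl.
by rewrite lebesgue_rV_cube// ltry.
Qed.

Definition ball_volume : R := fine (mu [set x | (enorm x < 1)%R]).

Lemma ball_volumeE : mu [set x | (enorm x < 1)%R] = ball_volume%:E.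
Proof. by rewrite fineK// ge0_fin_numE// ball_lty. Qed.

Lemma ball_volume_gt0 : 0 < ball_volume.
Proof.
rewrite -lte_fin -ball_volumeE.
(* A cube of half-side 1/(2n) stays within Euclidean distance 1/2 of its centre. *)
have r0 : 0 < (2 * n%:R)^-1 :> R by rewrite invr_gt0 mulr_gt0// ltr0n.
apply: (@lt_le_trans _ _ (mu (cube 0 (2 * n%:R)^-1))).
  by rewrite lebesgue_rV_cube// lte_fin exprn_gt0// mulr_gt0.
apply: le_measure; rewrite ?inE.
- exact: measurable_cube.
- exact: measurable_ball_enorm.
- move=> x /cube_enorm; rewrite subr0 /= => /le_lt_trans; apply.
  by rewrite invfM mulrCA divff ?mulr1 ?pnatr_eq0 ?gt_eqF//; lra.
Qed.

Lemma lebesgue_rV_ball r : 0 <= r ->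
  mu [set x | (enorm x < r)%R] = (r ^+ n * ball_volume)%:E.
Proof.
rewrite le_eqVlt => /predU1P[<-|r0].
  rewrite expr0n gtn_eqF//= mul0r (_ : [set _ | _] = set0) ?measure0//.
  by apply/seteqP; split => // x /=; rewrite ltNge enorm_ge0.
have := @lebesgue_rV_cone_ball setT r measurableT (fun _ _ _ => iff_refl _) r0.
by rewrite !setTI ball_volumeE EFinM.
Qed.

Lemma lebesgue_rV_annulus a b : 0 <= a -> a <= b ->
  mu (annulus a b) = ((b ^+ n - a ^+ n) * ball_volume)%:E.
Proof.
move=> a0 ab.
have -> : annulus a b = [set x | enorm x < b] `\` [set x | enorm x < a].
  apply/seteqP; split => x /=; rewrite /annulus/=.
    by move=> /andP[ax xb]; split => //; apply/negP; rewrite -leNgt.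
  by move=> [xb /negP]; rewrite -leNgt => ->.
rewrite measureD; try exact: measurable_ball_enorm; last exact: ball_lty.
rewrite setIidr/=; last by move=> x /= /lt_le_trans; apply.
by rewrite !lebesgue_rV_ball ?(le_trans a0)// -EFinB; congr EFin; ring.
Qed.

(** Follows from a^n <= a b^(n-1). *)
Lemma lebesgue_rV_annulus_ge a b : 0 <= a -> a <= b ->
  (((b - a) * b ^+ n.-1 * ball_volume)%:E <= mu (annulus a b))%E.
Proof.
move=> a0 ab; rewrite lebesgue_rV_annulus// lee_fin ler_wpM2r//.
  exact: ltW ball_volume_gt0.
rewrite mulrBl -exprS prednK// lerB// -[in leLHS](prednK n_gt0) exprS.
by rewrite ler_wpM2l// lerXn2r ?nnegrE// (le_trans a0).
Qed.

Section cone_average.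
Variable G : set 'rV[R]_n.
Hypotheses (mG : measurable G) (cG : cone G).
Local Open Scope ereal_scope.

Let cone_volume : R := fine (mu (G `&` [set x | (enorm x < 1)%R])).

Let cone_volume_ge0 : (0 <= cone_volume)%R.
Proof. exact: fine_ge0. Qed.

Let cone_volumeE : mu (G `&` [set x | (enorm x < 1)%R]) = cone_volume%:E.
Proof.
rewrite fineK// ge0_fin_numE//.
apply: (@le_lt_trans _ _ (mu [set x | (enorm x < 1)%R])); last exact: ball_lty.
apply: le_measure; rewrite ?inE; last exact: subIsetr.
- by apply: measurableI => //; exact: measurable_ball_enorm.
- exact: measurable_ball_enorm.
Qed.

(** Each distribution of [enorm] is weighted by the mass that the other gives to the unit ball;
    proportionality is thus stated without dividing by [cone_volume], which vanishes when [G] is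
    null. *)
Let m1 := mscale (NngNum (ltW ball_volume_gt0))
  (measure_function_pushforward__canonical__measure_function_Measure
    (mrestr mu mG) (@measurable_enorm R n)).
Let m2 := mscale (NngNum cone_volume_ge0)
  (measure_function_pushforward__canonical__measure_function_Measure
    mu (@measurable_enorm R n)).

(* Both measures of R are finite on rays and, by scaling, agree there. *)
Let m12 A : measurable A -> m1 A = m2 A.
Proof.
apply: (measure_unique (@RGenInftyO.G R) (fun k => `]-oo, k.+1%:R[%classic)).
- exact: RGenInftyO.measurableE.
- move=> _ _ [x ->] [y ->]; exists (Order.min x y).
  by apply/seteqP; split => z; rewrite /= !in_itv/= lt_min => /andP.
- by move=> i; exists i.+1%:R.
- apply/seteqP; split => // x _.
  exists (Num.truncn `|x|) => //; rewrite /= in_itv/=.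
  by rewrite (le_lt_trans (ler_norm x))// truncnS_gt.
- move=> _ [x ->].
  rewrite -[LHS]/(ball_volume%:E * mu ((@enorm R n @^-1` `]-oo, x[) `&` G)).
  rewrite -[RHS]/(cone_volume%:E * mu (@enorm R n @^-1` `]-oo, x[)).
  rewrite !enorm_ray setIC.
  have [x0|x0] := leP x 0%R.
    rewrite (_ : [set z | (enorm z < x)%R] = set0) ?setI0 ?measure0 ?mule0//.
    by apply/seteqP; split => // z /=; rewrite ltNge (le_trans x0)// enorm_ge0.
  rewrite lebesgue_rV_cone_ball// cone_volumeE lebesgue_rV_ball ?ltW//.
  by rewrite -!EFinM; congr EFin; ring.
- move=> k.
  rewrite -[X in X < _]/(ball_volume%:E * mu ((@enorm R n @^-1` `]-oo, k.+1%:R[) `&` G)) enorm_ray.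
  apply: lte_mul_pinfty; rewrite ?lee_fin ?ltW ?ball_volume_gt0//.
  apply: le_lt_trans (ball_lty k.+1%:R).
  apply: le_measure; rewrite ?inE; last exact: subIsetl.
  + by apply: measurableI => //; exact: measurable_ball_enorm.
  + exact: measurable_ball_enorm.
Qed.

Let cone_integral (D : set R) (h : R -> \bar R) : measurable D ->
  measurable_fun setT h -> (forall r, 0 <= h r) ->
  ball_volume%:E * \int[mu]_(x in G `&` (@enorm R n @^-1` D)) h (enorm x) =
  cone_volume%:E * \int[mu]_(x in @enorm R n @^-1` D) h (enorm x).
Proof.
move=> mD mh h0.
have mhD : measurable_fun D h by exact: measurable_funTS.
have mhe : measurable_fun setT (fun x : 'rV[R]_n => h (enorm x)).
  exact: (measurableT_comp mh (@measurable_enorm R n)).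
have mDe : measurable (@enorm R n @^-1` D) by exact: measurable_enorm_preimage.
have : \int[m1]_(r in D) h r = \int[m2]_(r in D) h r.
  by apply: eq_measure_integral => A mA _; exact: m12.
rewrite !ge0_integral_mscale// !ge0_integral_pushforward//.
(* The complement of [G] is null for the restricted measure, which agrees with [mu] on subsets of
   [G]. *)
rewrite (@ge0_negligible_integral _ _ _ (mrestr mu mG) _ (~` G)); last 5 first.
- exact: measurableC.
- exact: mDe.
- exact: measurable_funTS.
- by move=> x _; exact: h0.
- by rewrite /= /mrestr setICl measure0.
rewrite setDE setCK (eq_measure_integral mu); first by rewrite setIC.
by move=> A mA AG; rewrite /= /mrestr; congr (mu _); apply: setIidl => x /AG[].
Qed.

(** [cone_integral] is used for [h] and for the constant 1; eliminating [cone_volume] between the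
    two identities leaves a common factor [ball_volume], which is cancelled. *)
Lemma cone_average a b (h : R -> \bar R) :
  measurable_fun setT h -> (forall r, 0 <= h r) ->
  mu (annulus a b) * \int[mu]_(x in G `&` annulus a b) h (enorm x) =
  mu (G `&` annulus a b) * \int[mu]_(x in annulus a b) h (enorm x).
Proof.
move=> mh h0.
have mI : measurable (`[a, b[%classic : set R) by exact: measurable_itv.
have H1 := cone_integral mI mh h0.
have := cone_integral mI (measurable_cst 1) (fun=> lee01).
have mA := measurable_annulus a b.
have mGA : measurable (G `&` annulus a b) by exact: measurableI.
rewrite -annulusE in H1 *.
rewrite !integral_cst// !mul1e => H2.
have := congr1 (fun z => z * \int[mu]_(x in annulus a b) h (enorm x)) H2.
rewrite -!muleA (muleCA cone_volume%:E) -H1 (muleCA _ ball_volume%:E) => E.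
have bv0 : 0 < ball_volume%:E by rewrite lte_fin ball_volume_gt0.
by apply/eqP; rewrite eq_le; apply/andP; split; rewrite -(@lee_pmul2l _ ball_volume%:E)// E.
Qed.

End cone_average.
End annuli.

(** * A pointwise inequality for radial functions *)

Section hajlasz.
Context {R : realType}.
Variable n : nat.
Hypothesis n_gt0 : (0 < n)%N.
Local Notation mu := (@lebesgue_rV R n).
Variables (s : R) (f : R -> R).
Hypotheses (s_gt0 : 0 < s) (mf : measurable_fun setT f).
Local Notation U := (fun x : 'rV[R]_n => f (enorm x)).

Definition gagliardo_kernel (u : 'rV[R]_n -> R) (x y : 'rV[R]_n) : \bar R :=
  (`|u x - u y| ^+ 2 / enorm (x - y) `^ (n%:R + 2 * s))%:E.

Definition gagliardo_density u y : \bar R := \int[mu]_x gagliardo_kernel u x y.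

Lemma gagliardo_kernel_ge0 u x y : (0 <= gagliardo_kernel u x y)%E.
Proof. by rewrite lee_fin divr_ge0// ?exprn_ge0// powR_ge0. Qed.

Lemma gagliardo_density_ge0 u y : (0 <= gagliardo_density u y)%E.
Proof. by apply: integral_ge0 => x _; exact: gagliardo_kernel_ge0. Qed.

Lemma measurable_enorm_subl (y : 'rV[R]_n) : measurable_fun setT (fun x : 'rV[R]_n =>
  enorm (x - y)).
Proof.
apply: (measurableT_comp (@measurable_enorm R n)).
have := measurable_affine 1 (- y); apply: eq_measurable_fun => x _.
by rewrite scale1r.
Qed.

Lemma measurable_gagliardo_kernelx u y : measurable_fun setT u ->
  measurable_fun setT (gagliardo_kernel u ^~ y).
Proof.
move=> mu_; apply/measurable_EFinP; apply: measurable_funM.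
  apply: measurable_funX; apply: measurableT_comp => //.
  exact: measurable_funB.
under eq_fun do rewrite -powRN.
exact: (measurableT_comp (@measurable_powR R _) (measurable_enorm_subl y)).
Qed.

Let mU : measurable_fun setT U.
Proof. exact: (measurableT_comp mf (@measurable_enorm R n)). Qed.

(** Circular cone about the ray through [y]; [e] bounds the chord between the unit vectors x/|x| and
    y/|y|. *)
Definition cone_around (y : 'rV[R]_n) (e : R) : set 'rV[R]_n :=
  [set x | enorm (x - (enorm x / enorm y) *: y) <= e * enorm x].

Lemma cone_cone_around y e : cone (cone_around y e).
Proof.
move=> t x t0; rewrite /cone_around/= enormZ gtr0_norm//.
rewrite (_ : _ - _ = t *: (x - (enorm x / enorm y) *: y)); last first.
  by rewrite scalerBr scalerA mulrA.
by rewrite enormZ gtr0_norm// mulrCA ler_pM2l.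
Qed.

Lemma measurable_cone_around y e : measurable (cone_around y e).
Proof.
have -> : cone_around y e = (fun x => e * enorm x -
    enorm (x - (enorm x / enorm y) *: y)) @^-1` `[0, +oo[%classic.
  apply/seteqP; split => x; rewrite /cone_around/= in_itv/= andbT subr_ge0//.
rewrite -[X in measurable X]setTI.
suff : measurable_fun setT (fun x => e * enorm x -
    enorm (x - (enorm x / enorm y) *: y)).
  by move=> H; apply: H => //; exact: measurable_itv.
apply: measurable_funB.
  by apply: measurable_funM => //; exact: measurable_enorm.
apply: (measurableT_comp (@measurable_enorm R n)).
apply: measurable_fun_rVP => i; under eq_fun do rewrite !mxE.
apply: measurable_funB; first exact: measurable_coord.
do 2 (apply: measurable_funM => //); exact: measurable_enorm.
Qed.

(** The cube is centred on the axis at mid-height r + 3d/4 and has Euclidean radius at most d/8. A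
    point x of it is within d/8 + d/8 of the axis point of equal norm, and d/4 is below d/(r + d)
    times |x| because |x| >= r + d/2. The cone section thus has volume at least of order d^n. *)
Lemma cone_annulus_cube y r d : 0 < d -> 0 < r -> y != 0 ->
  cube (((r + 3 / 4 * d) / enorm y) *: y) (d / (8 * n%:R)) `<=`
  cone_around y (d / (r + d)) `&` annulus (r + d / 2) (r + d).
Proof.
move=> d0 r0; rewrite -enorm_gt0 => y0 x /cube_enorm.
have -> : n%:R * (d / (8 * n%:R)) = d / 8.
  by field; rewrite pnatr_eq0 gt_eqF.
set c := (_ *: y) => xc.
have cE : enorm c = r + 3 / 4 * d.
  rewrite enormZ ger0_norm ?divfK ?gt_eqF//.
  by rewrite divr_ge0 ?ltW// addr_gt0// mulr_gt0.
have xE : `|enorm x - (r + 3 / 4 * d)| <= d / 8.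
  by rewrite -cE; apply: le_trans (ler_dist_enorm _ _) xc.
have := xE; rewrite ler_norml => /andP[xE1 xE2].
split; last by rewrite /annulus/=; apply/andP; split; lra.
rewrite /cone_around/=.
have -> : x - (enorm x / enorm y) *: y =
    (x - c) + ((r + 3 / 4 * d - enorm x) / enorm y) *: y.
  by rewrite /c mulrBl scalerBl addrA subrK.
apply: le_trans (ler_enormD _ _) _.
rewrite enormZ normrM normfV (ger0_norm (ltW y0)) divfK ?gt_eqF// distrC.
apply: (@le_trans _ _ (d / 4)); first by lra.
rewrite mulrAC ler_pdivlMr; last by lra.
by rewrite -mulrA ler_wpM2l ?ltW//; lra.
Qed.

(** With aperture d/(r + d), a point of norm below r + d is within d of the axis point of equal
    norm, which itself is within d of [y]. *)
Lemma cone_annulus_dist y r d x : 0 < d -> 0 < r ->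
  r <= enorm y <= r + d ->
  cone_around y (d / (r + d)) x -> annulus (r + d / 2) (r + d) x ->
  enorm (x - y) <= 2 * d.
Proof.
move=> d0 r0 /andP[ry yrd]; rewrite /cone_around /annulus/= => cx /andP[x1 x2].
have y0 : 0 < enorm y by lra.
have -> : x - y = (x - (enorm x / enorm y) *: y) +
    ((enorm x - enorm y) / enorm y) *: y.
  by rewrite mulrBl scalerBl divff ?gt_eqF// scale1r addrA subrK.
apply: le_trans (ler_enormD _ _) _.
rewrite enormZ normrM normfV (ger0_norm (ltW y0)) divfK ?gt_eqF//.
rewrite (_ : 2 * d = d + d); last by ring.
apply: lerD.
  apply: (le_trans cx); rewrite mulrAC ler_pdivrMr; last by lra.
  by rewrite ler_wpM2l ?ltW.
by rewrite ler_norml; apply/andP; split; lra.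
Qed.

(** The first factor comes from |x - y| <= 2d in the kernel, the second from the volume (d/(4n))^n
    of the cube inside the cone. *)
Definition hajlasz_const : R := 2 `^ (n%:R + 2 * s) * (4 * n%:R) ^+ n.

Lemma hajlasz_const_gt0 : 0 < hajlasz_const.
Proof. by rewrite mulr_gt0 ?powR_gt0// exprn_gt0// mulr_gt0// ltr0n. Qed.

Local Open Scope ereal_scope.

Lemma annulus_deviation r d y : (0 < d)%R -> (0 < r)%R -> (r <= enorm y <= r + d)%R ->
  \int[mu]_(x in annulus (r + d / 2)%R (r + d)%R) (`|U x - U y| ^+ 2)%:E <=
  (hajlasz_const * d `^ (2 * s))%:E *
    (mu (annulus (r + d / 2)%R (r + d)%R) * gagliardo_density U y).
Proof.
move=> d0 r0 ryd.
have y0 : y != 0%R by rewrite -enorm_gt0; case/andP: ryd => ry _; lra.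
set A := annulus _ _.
set G := cone_around y (d / (r + d)).
have mA : measurable A by exact: measurable_annulus.
have mG : measurable G by exact: measurable_cone_around.
have n0 : (0 < n%:R :> R)%R by rewrite ltr0n.
have dn0 : (0 < (d / (4 * n%:R)) ^+ n)%R by rewrite exprn_gt0// divr_gt0// mulr_gt0.
(* With [U y] frozen, the integrand depends on x through [enorm x] only, so [cone_average]
   applies. *)
pose h (t : R) := (`|f t - U y| ^+ 2)%:E.
have mh : measurable_fun setT h.
  apply/measurable_EFinP; apply: measurable_funX; apply: measurableT_comp => //.
  exact: measurable_funB.
have h0 t : 0 <= h t by rewrite lee_fin exprn_ge0.
have mhe : measurable_fun setT (fun x : 'rV[R]_n => h (enorm x)).
  exact: (measurableT_comp mh (@measurable_enorm R n)).
have volGA : ((d / (4 * n%:R)) ^+ n)%:E <= mu (G `&` A).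
  have -> : (d / (4 * n%:R) = 2 * (d / (8 * n%:R)))%R by field; rewrite gt_eqF.
  rewrite -(@lebesgue_rV_cube _ _ (((r + 3 / 4 * d) / enorm y) *: y)%R); last first.
    by rewrite divr_gt0// mulr_gt0.
  apply: le_measure; rewrite ?inE.
  - exact: measurable_cube.
  - exact: measurableI.
  - exact: cone_annulus_cube.
have dev : \int[mu]_(x in G `&` A) h (enorm x) <=
    ((2 * d) `^ (n%:R + 2 * s))%:E * gagliardo_density U y.
  have mk := measurable_gagliardo_kernelx y mU.
  apply: (@le_trans _ _ (\int[mu]_(x in G `&` A) (((2 * d) `^ (n%:R + 2 * s))%:E *
      gagliardo_kernel U x y))).
    apply: ge0_le_integral => //.
    - exact: measurableI.
    - exact: measurable_funTS.
    - apply: measurable_funTS; exact: measurable_funeM.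
    - move=> x [Gx Ax]; rewrite /h /gagliardo_kernel -EFinM lee_fin.
      have [->|xy] := eqVneq x y.
        by rewrite subrr normr0 expr0n/= mul0r mulr0.
      have xy0 : (0 < enorm (x - y))%R by rewrite enorm_gt0 subr_eq0.
      rewrite mulrCA ler_peMr ?exprn_ge0// ler_pdivlMr ?powR_gt0// mul1r.
      apply: ge0_ler_powR; rewrite ?nnegrE.
      + by rewrite addr_ge0 ?ltW// mulr_gt0.
      + exact: enorm_ge0.
      + by rewrite mulr_ge0// ltW.
      + exact: cone_annulus_dist Gx Ax.
  rewrite ge0_integralZl_EFin//.
  - rewrite lee_wpmul2l ?lee_fin ?powR_ge0//.
    apply: ge0_subset_integral => //; first exact: measurableI.
    by move=> x _; exact: gagliardo_kernel_ge0.
  - exact: measurableI.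
  - by move=> x _; exact: gagliardo_kernel_ge0.
  - exact: measurable_funTS.
  - exact: powR_ge0.
have avg := cone_average n_gt0 mG (@cone_cone_around y _) (r + d / 2)%R (r + d)%R mh h0.
rewrite -/A -/G in avg.
(* Both sides are multiplied by the lower bound for the volume of the cone section, then
   [cone_average] trades the annulus for that section. *)
rewrite -(@lee_pmul2l _ ((d / (4 * n%:R)) ^+ n)%:E)//.
apply: (@le_trans _ _ (mu (G `&` A) * \int[mu]_(x in A) h (enorm x))).
  by rewrite lee_wpmul2r// integral_ge0.
rewrite -avg; apply: (le_trans (lee_wpmul2l _ dev)) => //.
rewrite muleCA [leRHS]muleA -EFinM.
rewrite le_eqVlt; apply/orP; left; apply/eqP; congr (_%:E * _).
rewrite /hajlasz_const powRM ?ltW//.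
rewrite (@powRD _ d); last by rewrite (gt_eqF d0) implybT.
rewrite powR_mulrn ?ltW// !expr_div_n.
by field; rewrite expf_neq0// gt_eqF// mulr_gt0.
Qed.

Lemma hajlasz r d y1 y2 : (0 < d)%R -> (0 < r)%R ->
  (r <= enorm y1 <= r + d)%R -> (r <= enorm y2 <= r + d)%R ->
  (`|U y1 - U y2| ^+ 2)%:E <= (2 * hajlasz_const * d `^ (2 * s))%:E *
    (gagliardo_density U y1 + gagliardo_density U y2).
Proof.
move=> d0 r0 hy1 hy2; pose A : set 'rV[R]_n := annulus (r + d / 2)%R (r + d)%R.
have mA : measurable A by exact: measurable_annulus.
have rd : (0 <= r + d / 2)%R by lra.
have Afin : mu A \is a fin_num by rewrite lebesgue_rV_annulus//; lra.
have A0 : 0 < mu A.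
  apply: lt_le_trans (lebesgue_rV_annulus_ge n_gt0 rd _); last by lra.
  by rewrite lte_fin !mulr_gt0 ?ball_volume_gt0 ?exprn_gt0//; lra.
have md y : measurable_fun A (fun x => (`|U x - U y| ^+ 2)%:E).
  apply: measurable_funTS; apply/measurable_EFinP; apply: measurable_funX.
  by apply: measurableT_comp => //; exact: measurable_funB.
(* The constant |U y1 - U y2|^2 is integrated over the common annulus; the defect in the pointwise
   inequality is the square of 2 U x - U y1 - U y2. *)
have : \int[mu]_(x in A) (cst (`|U y1 - U y2| ^+ 2)%:E x) <=
    \int[mu]_(x in A) (2%:E * ((`|U x - U y1| ^+ 2)%:E + (`|U x - U y2| ^+ 2)%:E)).
  apply: ge0_le_integral => //.
  - by move=> x _; rewrite lee_fin exprn_ge0.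
  - apply: measurable_funeM; apply: emeasurable_funD; exact: md.
  - move=> x Ax /=; rewrite -EFinD -EFinM lee_fin !real_normK ?num_real//.
    by have := sqr_ge0 (2 * U x - U y1 - U y2); nra.
have sq0 y x : 0 <= (`|U x - U y| ^+ 2)%:E by rewrite lee_fin exprn_ge0.
rewrite integral_cst// ge0_integralZl_EFin//; last 2 first.
  by move=> x _; exact: adde_ge0.
  by apply: emeasurable_funD; exact: md.
rewrite ge0_integralD//.
have h1 := annulus_deviation d0 r0 hy1; have h2 := annulus_deviation d0 r0 hy2.
have h20 : 0 <= 2%:E :> \bar R by rewrite lee_fin.
move=> /le_trans /(_ (lee_wpmul2l h20 (leeD h1 h2))).
have g0 y : 0 <= mu A * gagliardo_density U y.
  by rewrite mule_ge0// gagliardo_density_ge0.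
rewrite -[in X in _ <= X -> _]ge0_muleDr// -ge0_muleDr ?gagliardo_density_ge0//.
rewrite (muleA 2%:E) -EFinM muleCA [X in X <= _ -> _]muleC lee_pmul2l//.
by rewrite mulrA.
Qed.

End hajlasz.

(** * The continuous radial profile *)

Section selection.
Context d (T : measurableType d) (R : realType).
Variable mu : {measure set T -> \bar R}.
Local Open Scope ereal_scope.

(** If [h] exceeded its mean [k] on [A] outside the exceptional null set, [h - k] would be positive
    there with integral 0, and [A] would be null. Carrying [P] along lets the point have an almost
    everywhere property as well. *)
Lemma exists_le_average (A : set T) (P : T -> Prop) (h : T -> \bar R) :
  measurable A -> 0 < mu A < +oo -> {ae mu, forall x, P x} ->
  measurable_fun A h -> (forall x, 0 <= h x) -> \int[mu]_(x in A) h x < +oo ->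
  exists y, [/\ A y, P y & mu A * h y <= \int[mu]_(x in A) h x].
Proof.
move=> mA /andP[A0 Aoo] [N [mN N0 PN]] mh h0 Ioo.
pose B := A `\` N.
have mB : measurable B by exact: measurableD.
have mhB : measurable_fun B h by apply: measurable_funS mh => //; exact: subDsetl.
have BA : mu B = mu A.
  have mu_I : mu (A `&` N) = 0.
    apply/eqP; rewrite eq_le measure_ge0 andbT -N0.
    by apply: le_measure; rewrite ?inE//; exact: measurableI.
  have E : mu A = mu B + mu (A `&` N) := measureDI mu mA mN.
  by rewrite E mu_I adde0.
rewrite (ge0_negligible_integral _ _ _ _ N0)//.
rewrite (ge0_negligible_integral _ _ _ _ N0)// in Ioo.
rewrite -/B in Ioo *.
set I := \int[mu]_(x in B) h x in Ioo *.
have I0 : 0 <= I by exact: integral_ge0.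
have If : I \is a fin_num by rewrite ge0_fin_numE.
have mf : mu A \is a fin_num by rewrite ge0_fin_numE// ltW.
have m0 : (0 < fine (mu A))%R by apply: fine_gt0; rewrite A0.
apply: contrapT => noy.
pose k := (fine I / fine (mu A))%R.
have k0 : (0 <= k)%R by rewrite divr_ge0 ?fine_ge0// ltW.
have kI : k%:E * mu B = I.
  by rewrite BA -[mu A]fineK// -EFinM divfK ?gt_eqF// fineK.
have hk x : B x -> k%:E < h x.
  move=> [Ax Nx]; rewrite ltNge; apply/negP => hxk; apply: noy; exists x; split => //.
    by apply: contrapT => /PN.
  rewrite -kI BA muleC; rewrite [leLHS]muleC [leRHS]muleC lee_wpmul2l// ltW//.
have mhk : measurable_fun B (fun x => h x - k%:E).
  by apply: emeasurable_funB => //; exact: measurable_cst.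
have hk0 x : B x -> 0 <= h x - k%:E by move=> /hk/ltW; rewrite sube_ge0.
have IE : I = \int[mu]_(x in B) (h x - k%:E) + I.
  rewrite -[in RHS]kI -integral_cst// -ge0_integralD//.
  by apply: eq_integral => x _; rewrite subeK.
have J0 : \int[mu]_(x in B) (h x - k%:E) = 0.
  by have := congr1 (fun z => z - I) IE; rewrite addeK// subee.
have : \int[mu]_(x in B) `|h x - k%:E| = 0.
  by rewrite -J0; apply: eq_integral => x; rewrite inE => /hk0 /gee0_abs.
move/(ae_eq_integral_abs _ mB mhk) => [M [mM M0 BM]].
have : mu B <= mu M.
  apply: le_measure; rewrite ?inE// => x Bx; apply: BM => /= /(_ Bx) E.
  by have := hk x Bx; rewrite -sube_gt0 E ltxx.
by rewrite M0 BA leNgt A0.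
Qed.

End selection.

Section profile.
Context {R : realType}.

Lemma powR2N_lt1 (a : R) : 0 < a -> 2 `^ (- a) < 1 :> R.
Proof.
move=> a0; rewrite powRN invf_lt1 ?powR_gt0//.
have : (1 : R) `^ a < 2 `^ a by apply: gt0_ltr_powR; rewrite ?nnegrE//; lra.
by rewrite powR1.
Qed.

(** The limit d -> 0 made explicit: for positive x, a [d] with E d^a <= x/2 contradicts the
    bound. *)
Lemma powR_small_le0 (a E x : R) : 0 < a ->
  (forall d, 0 < d <= 1 -> x <= E * d `^ a) -> x <= 0.
Proof.
move=> a0 H; rewrite leNgt; apply/negP => x0.
have E0 : 0 < E.
  by have := H 1; rewrite powR1 mulr1 ltr01 lexx => /(_ isT); lra.
pose d := Num.min 1 ((x / (2 * E)) `^ a^-1).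
have d0 : 0 < d by rewrite lt_min ltr01 powR_gt0// divr_gt0// mulr_gt0.
have := H d; rewrite d0 ge_min lexx => /(_ isT).
apply/negP; rewrite -ltNge.
have dE : d `^ a <= x / (2 * E).
  have -> : x / (2 * E) = ((x / (2 * E)) `^ a^-1) `^ a.
    by rewrite -powRrM mulVf ?gt_eqF// powRr1// divr_ge0 ?mulr_ge0 ?ltW.
  apply: ge0_ler_powR; rewrite ?nnegrE ?powR_ge0 ?(ltW a0) ?(ltW d0)//.
  by rewrite ge_min lexx orbT.
apply: (@le_lt_trans _ _ (x / 2)); last by lra.
by apply: le_trans (ler_wpM2l (ltW E0) dE) _; rewrite le_eqVlt; apply/orP; left;
  apply/eqP; field; rewrite gt_eqF.
Qed.

(** Completeness in the form used for the profile: a point common to pairwise intersecting closed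
    intervals replaces a limit. *)
Lemma between_exists (I : Type) (i0 : I) (lo hi : I -> R) :
  (forall i j, lo i <= hi j) -> exists v, forall i, lo i <= v <= hi i.
Proof.
move=> H; exists (sup (range lo)) => i.
have ub : has_sup (range lo).
  by split; [exists (lo i0); exists i0|exists (hi i0) => _ [j _ <-]].
apply/andP; split; first by apply: ub_le_sup; [exact: ub.2|exists i].
by apply: ge_sup; [exact: ub.1|move=> _ [j _ <-]].
Qed.

(** Abstract form of the dyadic argument: [c r d] stands for the value of the radial function at a
    point selected in the annulus of radius [r] and thickness [d], and [B r] for a local Hoelder
    constant. *)
Variable (a : R) (c : R -> R -> R) (B : R -> R).
Hypotheses (a_gt0 : 0 < a) (B_ge0 : forall r, 0 < r -> 0 <= B r).
Hypothesis B_mono : forall r r', 0 < r -> r <= r' -> B r' <= B r.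
Hypothesis c_scale : forall r d d', 0 < r -> 0 < d -> d / 2 <= d' <= d ->
  `|c r d - c r d'| <= B r * d `^ a.
Hypothesis c_shift : forall r d, 0 < r -> 0 < d ->
  `|c r d - c (r + d) d| <= B r * d `^ a.

(** Sum of the geometric series of ratio 2^(-a), the cost of passing through all dyadic scales. *)
Definition geometric_const : R := (1 - 2 `^ (- a))^-1.

Lemma geometric_const_gt0 : 0 < geometric_const.
Proof. by rewrite invr_gt0 subr_gt0 powR2N_lt1. Qed.

(** [d] is halved until it is within a factor 2 of [d']; the induction runs on a bound for the
    number of halvings. *)
Let c_chain r d d' : 0 < r -> 0 < d' -> d' <= d ->
  `|c r d - c r d'| <= geometric_const * B r * d `^ a.
Proof.
move=> r0 d'0.
have half_lt1 := powR2N_lt1 a_gt0.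
have L1 : 1 <= geometric_const.
  by rewrite -[leLHS]invr1 lef_pV2 ?posrE ?subr_gt0// gerBl powR_ge0.
have [k] : exists k, d <= 2 ^+ k * d'.
  exists (Num.truncn `|d / d'|).+1; rewrite -ler_pdivrMr//.
  apply: le_trans (ler_norm _) _.
  apply: (@le_trans _ _ (Num.truncn `|d / d'|).+1%:R); first by rewrite ltW// truncnS_gt.
  by rewrite -natrX ler_nat ltnW// ltn_expl.
elim: k d => [|k ih] d dk dd'.
  have -> : d = d' by apply/eqP; rewrite eq_le dd'; move: dk; rewrite expr0 mul1r => ->.
  by rewrite subrr normr0 !mulr_ge0 ?powR_ge0 ?B_ge0 ?ltW ?geometric_const_gt0.
have d0 : 0 < d by lra.
have [dd2|dd2] := leP (d / 2) d'.
  apply: (@le_trans _ _ (B r * d `^ a)); first by apply: c_scale => //; rewrite dd2.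
  by rewrite -mulrA ler_peMl// mulr_ge0 ?powR_ge0 ?B_ge0.
have -> : c r d - c r d' = (c r d - c r (d / 2)) + (c r (d / 2) - c r d') by ring.
apply: le_trans (ler_normD _ _) _.
have h1 : `|c r d - c r (d / 2)| <= B r * d `^ a.
  by apply: c_scale => //; apply/andP; split; lra.
have h2 : `|c r (d / 2) - c r d'| <= geometric_const * B r * (d / 2) `^ a.
  by apply: ih; [move: dk; rewrite exprS; lra|exact: ltW].
apply: (le_trans (lerD h1 h2)).
rewrite powRM// ?(ltW d0)// -powR_inv1// -powRrM mulN1r.
(* The equation satisfied by the geometric sum closes the induction. *)
have E : 1 + geometric_const * 2 `^ (- a) = geometric_const.
  by rewrite /geometric_const; field; rewrite subr_eq0 eq_sym lt_eqF.
rewrite -[in leRHS]E le_eqVlt; apply/orP; left; apply/eqP; ring.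
Qed.

Lemma profile_exists : exists w : R -> R,
  (forall r d, 0 < r -> 0 < d -> `|w r - c r d| <= geometric_const * B r * d `^ a) /\
  (forall r r', 0 < r -> r < r' ->
     `|w r - w r'| <= (2 * geometric_const + 1) * B r * (r' - r) `^ a).
Proof.
have L0 := geometric_const_gt0.
have /choice[w wP] : forall r, exists v : R, forall d, 0 < r -> 0 < d ->
    `|v - c r d| <= geometric_const * B r * d `^ a.
  move=> r.
  have [r0|r0] := leP r 0; first by exists 0 => d r'; lra.
  (* One interval about [c r d] for each scale [d]; two of them meet because the error at the larger
     scale dominates the distance of the centres. *)
  pose lo (i : {x : R | 0 < x}) := c r (sval i) - geometric_const * B r * sval i `^ a.
  pose hi (i : {x : R | 0 < x}) := c r (sval i) + geometric_const * B r * sval i `^ a.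
  have lohi i j : lo i <= hi j.
    case: i j => [d d0] [d' d'0]; rewrite /lo /hi /=.
    have p x : 0 <= geometric_const * B r * x `^ a.
      by rewrite !mulr_ge0 ?powR_ge0 ?B_ge0// ltW.
    have [dd|dd] := leP d' d.
      have := c_chain r0 d'0 dd; have := p d'; rewrite ler_norml => ? /andP[? ?].
      by lra.
    have := c_chain r0 d0 (ltW dd); have := p d; rewrite ler_norml => ? /andP[? ?].
    by lra.
  have [v vP] := between_exists (exist _ 1 ltr01) lohi.
  exists v => d _ d0; have := vP (exist _ d d0); rewrite /lo /hi /= => /andP[? ?].
  by rewrite ler_norml; apply/andP; split; lra.
exists w; split => // r r' r0 rr'.
(* The comparison is made at the scale r' - r, where [c_shift] leads from r exactly to r'. *)
have d0 : 0 < r' - r by lra.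
have r'0 : 0 < r' by lra.
have h1 := wP r _ r0 d0; have h2 := wP r' _ r'0 d0.
have h3 := c_shift r0 d0; rewrite (addrC r) subrK in h3.
have h4 : geometric_const * B r' * (r' - r) `^ a <= geometric_const * B r * (r' - r) `^ a.
  by rewrite ler_wpM2r ?powR_ge0// ler_wpM2l ?(ltW L0)//; exact: B_mono (ltW rr').
have -> : w r - w r' = (w r - c r (r' - r)) + (c r (r' - r) - c r' (r' - r)) +
  - (w r' - c r' (r' - r)) by ring.
apply: le_trans (ler_normD _ _) _; rewrite normrN.
apply: le_trans (lerD (ler_normD _ _) (lexx _)) _.
by lra.
Qed.

End profile.

Section density_measurability.
Context {R : realType}.
Variable n : nat.
Local Notation mu := (@lebesgue_rV R n).
Variables (s : R) (u : 'rV[R]_n -> R).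
Hypothesis mu_ : measurable_fun setT u.

Lemma measurable_gagliardo_kernel :
  measurable_fun setT (fun p : 'rV[R]_n * 'rV[R]_n => gagliardo_kernel s u p.1 p.2).
Proof.
apply/measurable_EFinP; apply: measurable_funM.
  apply: measurable_funX; apply: measurableT_comp => //; apply: measurable_funB.
    exact: (measurableT_comp mu_ measurable_fst).
  exact: (measurableT_comp mu_ measurable_snd).
under eq_fun do rewrite -powRN.
apply: (measurableT_comp (@measurable_powR R _)).
exact: (measurableT_comp (@measurable_enorm R n) (@measurable_sub_pair R n)).
Qed.

Lemma measurable_gagliardo_density : measurable_fun setT (gagliardo_density s u).
Proof.
apply: (measurable_fun_fubini_tonelli_G (m1 := mu)
  (fun p : 'rV[R]_n * 'rV[R]_n => gagliardo_kernel s u p.1 p.2)).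
- exact: measurable_gagliardo_kernel.
- by move=> p; exact: gagliardo_kernel_ge0.
Qed.

End density_measurability.

Section radial_morrey.
Context {R : realType}.
Variable n : nat.
Hypothesis n_gt0 : (0 < n)%N.
Local Notation mu := (@lebesgue_rV R n).
Variable s : R.
Hypothesis s_gt : 1 / 2 < s.
Local Notation H := (hajlasz_const n s).
Local Notation omega := (@ball_volume R n).
Local Notation alpha := (s - 1 / 2).

Let s_gt0 : 0 < s.
Proof. by move: s_gt => h; lra. Qed.

(** The single factor [d] is cancelled by the thickness of the annulus when the density is averaged,
    which leaves the square of the Hoelder modulus. *)
Let powR_split (d : R) : 0 < d -> d `^ (2 * s) = d * (d `^ alpha) ^+ 2.
Proof.
move=> d0; rewrite -powR_mulrn ?powR_ge0// -powRrM.
have {2}-> : d = d `^ 1 by rewrite powRr1 ?ltW.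
rewrite -powRD; last by rewrite (gt_eqF d0) implybT.
by congr (_ `^ _); field.
Qed.

(** The outer factor is that of [profile_exists]. Under the root, 12 comes from changing the scale
    and 8 times 2^(2s) from shifting the radius; their sum serves for both. *)
Definition morrey_const : R :=
  (2 * geometric_const alpha + 1) * Num.sqrt ((12 + 8 * 2 `^ (2 * s)) * H / omega).

Lemma morrey_const_ge0 : 0 <= morrey_const.
Proof.
rewrite mulr_ge0 ?sqrtr_ge0// addr_ge0// mulr_ge0// ltW// geometric_const_gt0//.
by rewrite subr_gt0.
Qed.

Variables (f : R -> R) (D : R).
Local Notation U := (fun x : 'rV[R]_n => f (enorm x)).
Hypothesis mf : measurable_fun setT f.
Hypothesis DE : (\int[mu]_y gagliardo_density s U y = D%:E)%E.

Let mU : measurable_fun setT U.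
Proof. exact: (measurableT_comp mf (@measurable_enorm R n)). Qed.

Let D_ge0 : 0 <= D.
Proof.
rewrite -lee_fin -DE; apply: integral_ge0 => y _; exact: gagliardo_density_ge0.
Qed.

Let hajlasz_fin r d (y1 y2 : 'rV[R]_n) q1 q2 : 0 < d -> 0 < r ->
  r <= enorm y1 <= r + d -> r <= enorm y2 <= r + d ->
  (gagliardo_density s U y1 <= q1%:E)%E -> (gagliardo_density s U y2 <= q2%:E)%E ->
  `|U y1 - U y2| ^+ 2 <= 2 * H * (d * (d `^ alpha) ^+ 2) * (q1 + q2).
Proof.
move=> d0 r0 h1 h2 g1 g2; rewrite -powR_split// -lee_fin [leRHS]EFinM.
apply: (le_trans (hajlasz n_gt0 s_gt0 mf d0 r0 h1 h2)).
have ? := ltW (hajlasz_const_gt0 n_gt0 s).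
by rewrite lee_wpmul2l ?EFinD ?leeD// lee_fin !mulr_ge0 ?powR_ge0.
Qed.

(** The annulus has volume at least omega d r^(n-1) / 2, which bounds the mean of the density over
    it. *)
Let select r d : 0 < r -> 0 < d -> exists y : 'rV[R]_n,
  r + d / 2 <= enorm y < r + d /\
  (gagliardo_density s U y <= (2 / omega / d * (D / r ^+ n.-1))%:E)%E.
Proof.
move=> r0 d0; have w0 := ball_volume_gt0 (R := R) n_gt0.
have rd : 0 <= r + d / 2 by lra.
pose A : set 'rV[R]_n := annulus (r + d / 2) (r + d).
have mA : measurable A by exact: measurable_annulus.
have lowA : ((omega * d * r ^+ n.-1 / 2)%:E <= mu A)%E.
  apply: le_trans (lebesgue_rV_annulus_ge n_gt0 rd _); last by lra.
  rewrite lee_fin.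
  have : r ^+ n.-1 <= (r + d) ^+ n.-1 by rewrite lerXn2r ?nnegrE; lra.
  have -> : r + d - (r + d / 2) = d / 2 by lra.
  move=> le; rewrite (_ : omega * d * r ^+ n.-1 / 2 = d / 2 * omega * r ^+ n.-1).
    by rewrite [leRHS]mulrAC ler_wpM2l// mulr_ge0; lra.
  by ring.
have pos : 0 < omega * d * r ^+ n.-1 / 2.
  by rewrite divr_gt0// !mulr_gt0// exprn_gt0.
have Afin : (0 < mu A < +oo)%E.
  rewrite (lt_le_trans _ lowA) ?lte_fin//= lebesgue_rV_annulus ?ltry//; lra.
have mg := measurable_gagliardo_density s mU.
have gA : (\int[mu]_(y in A) gagliardo_density s U y <= D%:E)%E.
  rewrite -DE; apply: ge0_subset_integral => // x _; exact: gagliardo_density_ge0.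
have [y [Ay _ gy]] : exists y, [/\ A y, True &
    (mu A * gagliardo_density s U y <= \int[mu]_(y in A) gagliardo_density s U y)%E].
  apply: exists_le_average => //.
  - by apply: aeW.
  - exact: measurable_funTS.
  - by move=> x; exact: gagliardo_density_ge0.
  - by apply: (le_lt_trans gA); rewrite ltry.
exists y; split => //.
rewrite -(@lee_pmul2l _ (omega * d * r ^+ n.-1 / 2)%:E)// -EFinM.
apply: (@le_trans _ _ D%:E); last first.
  rewrite lee_fin le_eqVlt; apply/orP; left; apply/eqP; field.
  by rewrite expf_neq0 ?gt_eqF.
apply: le_trans gA; apply: le_trans gy.
by rewrite lee_wpmul2r// gagliardo_density_ge0.
Qed.

Let sqr_bound (x B e : R) : 0 <= e -> `|x| ^+ 2 <= B * e ^+ 2 ->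
  `|x| <= Num.sqrt B * e.
Proof.
move=> e0 h; have [B0|B0] := leP 0 B.
  rewrite -(@ler_pXn2r _ 2) ?nnegrE ?mulr_ge0 ?sqrtr_ge0//.
  by rewrite exprMn sqr_sqrtr.
(* For negative [B] the root is 0 by convention, and the hypothesis forces x = 0. *)
have -> : Num.sqrt B = 0 by apply/ler0_sqrtr/ltW.
have : `|x| ^+ 2 <= 0.
  by apply: (le_trans h); rewrite mulr_le0_ge0 ?exprn_ge0 ?(ltW B0).
by rewrite mul0r real_normK ?num_real// => h2; rewrite normr_le0 -sqrf_eq0 eq_le h2 sqr_ge0.
Qed.

Lemma radial_profile : exists w : R -> R,
  (forall r r', 0 < r -> r < r' -> `|w r - w r'| <=
     morrey_const * Num.sqrt (D / r ^+ n.-1) * (r' - r) `^ alpha) /\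
  (forall y, y != 0 -> (gagliardo_density s U y < +oo)%E -> U y = w (enorm y)).
Proof.
have w0 := ball_volume_gt0 (R := R) n_gt0.
have H0 := hajlasz_const_gt0 n_gt0 s.
have a0 : 0 < alpha by rewrite subr_gt0.
pose Q r := D / r ^+ n.-1.
have Q0 r : 0 < r -> 0 <= Q r by move=> r0; rewrite divr_ge0// exprn_ge0// ltW.
have Qmono r r' : 0 < r -> r <= r' -> Q r' <= Q r.
  move=> r0 rr'; rewrite ler_wpM2l// lef_pV2 ?posrE ?exprn_gt0//; last lra.
  by rewrite lerXn2r ?nnegrE//; lra.
pose M := (12 + 8 * 2 `^ (2 * s)) * H / omega.
have p2 : 0 < 2 `^ (2 * s) by apply: powR_gt0.
have M0 : 0 <= M.
  by rewrite divr_ge0 ?mulr_ge0 ?addr_ge0 ?mulr_ge0 ?(ltW p2) ?(ltW H0) ?(ltW w0).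
(* One point is selected for each radius and scale; the value 0 at other arguments is a default. *)
have /choice[c cP] : forall p : R * R, exists v : R, 0 < p.1 -> 0 < p.2 ->
    exists y : 'rV[R]_n, [/\ v = U y, p.1 + p.2 / 2 <= enorm y < p.1 + p.2 &
    (gagliardo_density s U y <= (2 / omega / p.2 * Q p.1)%:E)%E].
  move=> [r d]/=; have [[r0 d0]|nrd] := pselect (0 < r /\ 0 < d).
    by have [y [h1 h2]] := select r0 d0; exists (U y) => _ _; exists y.
  by exists 0 => r0 d0; case: nrd.
pose B r := Num.sqrt (M * Q r).
have [||||w [wc wh]] := @profile_exists _ alpha (fun r d => c (r, d)) B a0.
- by move=> r r0; exact: sqrtr_ge0.
- move=> r r' r0 rr'; rewrite ler_wsqrtr// ler_wpM2l//; exact: Qmono.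
(* Change of scale: both points have norm in [r, r + d], and d' >= d/2 makes the density bound at d'
   at most twice the one at d. *)
- move=> r d d' r0 d0 /andP[dd1 dd2]; have d'0 : 0 < d' by lra.
  have [y1 [-> /andP[y1a y1b] g1]] := cP (r, d) r0 d0.
  have [y2 [-> /andP[y2a y2b] g2]] := cP (r, d') r0 d'0.
  rewrite /= in y1a y1b y2a y2b g1 g2.
  apply: sqr_bound; first exact: powR_ge0.
  apply: (le_trans (@hajlasz_fin r d _ _ _ _ d0 r0 _ _ g1 g2)).
    by apply/andP; split; lra.
    by apply/andP; split; lra.
  have : 2 / omega / d' * Q r <= 2 / omega / (d / 2) * Q r.
    rewrite ler_wpM2r ?Q0// ler_wpM2l ?divr_ge0 ?(ltW w0)// lef_pV2 ?posrE//.
    by lra.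
  move=> h; apply: (@le_trans _ _ (2 * H * (d * (d `^ alpha) ^+ 2) *
     (2 / omega / d * Q r + 2 / omega / (d / 2) * Q r))).
    rewrite ler_wpM2l ?lerD2l//.
    by rewrite !mulr_ge0 ?exprn_ge0 ?powR_ge0 ?(ltW H0) ?(ltW d0).
  rewrite -subr_ge0.
  have -> : M * Q r * (d `^ alpha) ^+ 2 - 2 * H * (d * (d `^ alpha) ^+ 2) *
     (2 / omega / d * Q r + 2 / omega / (d / 2) * Q r) =
     8 * 2 `^ (2 * s) * H / omega * Q r * (d `^ alpha) ^+ 2.
    by rewrite /M; field; rewrite !gt_eqF.
  by rewrite !mulr_ge0 ?invr_ge0 ?exprn_ge0 ?powR_ge0 ?(ltW r0) ?(ltW H0) ?(ltW w0).
(* Shift of the radius: both points have norm in [r, r + 2d], so the pointwise inequality is used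
   with thickness 2d, whence the factor 2^(2s). *)
- move=> r d r0 d0; have r'0 : 0 < r + d by lra.
  have [y1 [-> /andP[y1a y1b] g1]] := cP (r, d) r0 d0.
  have [y2 [-> /andP[y2a y2b] g2]] := cP (r + d, d) r'0 d0.
  rewrite /= in y1a y1b y2a y2b g1 g2.
  have dd0 : 0 < 2 * d by lra.
  apply: sqr_bound; first exact: powR_ge0.
  apply: (le_trans (@hajlasz_fin r (2 * d) _ _ _ _ dd0 r0 _ _ g1 g2)).
    by apply/andP; split; lra.
    by apply/andP; split; lra.
  have Qrd : Q (r + d) <= Q r by apply: Qmono => //; lra.
  have h : 2 / omega / d * Q (r + d) <= 2 / omega / d * Q r.
    by rewrite ler_wpM2l// !divr_ge0 ?(ltW w0) ?(ltW d0).
  rewrite -powR_split//.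
  apply: (@le_trans _ _ (2 * H * (2 * d) `^ (2 * s) *
     (2 / omega / d * Q r + 2 / omega / d * Q r))).
    by rewrite ler_wpM2l ?lerD2l// !mulr_ge0 ?powR_ge0 ?(ltW H0) ?(ltW d0).
  rewrite powRM ?(ltW d0)// (powR_split d0) -subr_ge0.
  have -> : M * Q r * (d `^ alpha) ^+ 2 - 2 * H * (2 `^ (2 * s) *
     (d * (d `^ alpha) ^+ 2)) * (2 / omega / d * Q r + 2 / omega / d * Q r) =
     12 * H / omega * Q r * (d `^ alpha) ^+ 2.
    by rewrite /M; field; rewrite !gt_eqF.
  by rewrite !mulr_ge0 ?invr_ge0 ?exprn_ge0 ?powR_ge0 ?(ltW r0) ?(ltW H0) ?(ltW w0).
exists w; split.
  move=> r r' r0 rr'; apply: (le_trans (wh r r' r0 rr')).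
  by rewrite /B sqrtrM// mulrA.
move=> y y0 gy; have r0 : 0 < enorm y by rewrite enorm_gt0.
set r := enorm y in r0 *.
pose g := fine (gagliardo_density s U y).
have gE : gagliardo_density s U y = g%:E.
  by rewrite fineK// ge0_fin_numE// gagliardo_density_ge0.
have g0 : 0 <= g by rewrite fine_ge0// gagliardo_density_ge0.
apply/eqP; rewrite -subr_eq0 -normr_le0; apply/eqP.
(* The value at [y] is compared with the selected values as d -> 0; the finite density [g] at [y]
   enters through d g <= g, valid for d <= 1. *)
apply/eqP; apply: (powR_small_le0 (a := alpha)
  (E := Num.sqrt (2 * H * (g + 2 / omega * Q r)) + geometric_const alpha * B r) a0).
move=> d /andP[d0 d1].
have [z [zE /andP[za zb] gz]] := cP (r, d) r0 d0.
rewrite /= in za zb gz.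
have -> : f r - w r = (f r - c (r, d)) + - (w r - c (r, d)) by ring.
apply: (le_trans (ler_normD _ _)); rewrite normrN mulrDl lerD//; last exact: wc.
apply: sqr_bound; first exact: powR_ge0.
have gy' : (gagliardo_density s U y <= g%:E)%E by rewrite gE.
rewrite zE; apply: (le_trans (@hajlasz_fin r d _ _ _ _ d0 r0 _ _ gy' gz)).
  by rewrite -/r lexx lerDl ltW.
  by apply/andP; split; lra.
have -> : 2 * H * (d * (d `^ alpha) ^+ 2) * (g + 2 / omega / d * Q r) =
  2 * H * (d * g + 2 / omega * Q r) * (d `^ alpha) ^+ 2.
  by field; rewrite !gt_eqF.
rewrite ler_wpM2r ?exprn_ge0 ?powR_ge0// ler_wpM2l ?mulr_ge0 ?(ltW H0)// lerD2r.
by rewrite ler_piMl.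
Qed.

End radial_morrey.

(** * Interpolation between the Hoelder bound and the weighted norm *)

Section optimization.
Context {R : realType}.

(** The scale d = (B/A)^(1/(alpha + beta)) makes both terms equal, hence the factor 2. If A = 0 or B
    = 0 no positive scale balances them, and d tends to infinity or to 0 instead. *)
Lemma le_scale_optimum (alpha beta A B x : R) : 0 < alpha -> 0 < beta ->
  0 <= A -> 0 <= B ->
  (forall d, 0 < d -> x <= A * d `^ alpha + B * d `^ (- beta)) ->
  x <= 2 * (A `^ (beta / (alpha + beta)) * B `^ (alpha / (alpha + beta))).
Proof.
move=> a0 b0 A0 B0 H.
have ab0 : 0 < alpha + beta by rewrite addr_gt0.
have th0 : 0 < beta / (alpha + beta) by rewrite divr_gt0.
have th1 : 0 < alpha / (alpha + beta) by rewrite divr_gt0.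
have [AE|An0] := eqVneq A 0.
  rewrite AE powR0 ?gt_eqF// mul0r mulr0.
  apply: (powR_small_le0 (a := beta) (E := B)) => // d /andP[d0 _].
  have := H d^-1; rewrite invr_gt0 AE mul0r add0r => /(_ d0).
  by rewrite -(powR_inv1 (ltW d0)) -powRrM mulrNN mul1r.
have [BE|Bn0] := eqVneq B 0.
  rewrite BE (@powR0 _ (alpha / _)) ?gt_eqF// mulr0 mulr0.
  apply: (powR_small_le0 (a := alpha) (E := A)) => // d /andP[d0 _].
  by have := H d d0; rewrite BE mul0r addr0.
have {An0}Agt : 0 < A by rewrite lt0r An0.
have {Bn0}Bgt : 0 < B by rewrite lt0r Bn0.
have d0 : 0 < (B / A) `^ (alpha + beta)^-1 by rewrite powR_gt0// divr_gt0.
apply: (le_trans (H _ d0)); rewrite -!powRrM.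
have divE t : (B / A) `^ t = B `^ t * A `^ (- t).
  rewrite powRM ?invr_ge0//; congr (_ * _).
  by rewrite -(powR_inv1 A0) -powRrM mulN1r.
have powE p t : p + t = 1 -> A * (B / A) `^ t = A `^ p * B `^ t.
  move=> pt; rewrite divE mulrCA mulrC; congr (_ * _).
  rewrite -{1}(powRr1 A0) -powRD ?(gt_eqF Agt) ?implybT//.
  by congr (_ `^ _); lra.
have powE' p t : p + t = 1 -> B * (B / A) `^ (- p) = A `^ p * B `^ t.
  move=> pt; rewrite divE opprK mulrA mulrC; congr (_ * _).
  rewrite -{1}(powRr1 B0) -powRD ?(gt_eqF Bgt) ?implybT//.
  by congr (_ `^ _); lra.
have E1 : A * (B / A) `^ ((alpha + beta)^-1 * alpha) =
   A `^ (beta / (alpha + beta)) * B `^ (alpha / (alpha + beta)).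
  by rewrite (mulrC _^-1); apply: powE; field; rewrite gt_eqF.
have E2 : B * (B / A) `^ ((alpha + beta)^-1 * - beta) =
   A `^ (beta / (alpha + beta)) * B `^ (alpha / (alpha + beta)).
  by rewrite mulrN (mulrC _^-1); apply: powE'; field; rewrite gt_eqF.
by rewrite E1 E2; lra.
Qed.

End optimization.

Section strauss.
Context {R : realType}.
Variable n : nat.
Hypothesis n_gt0 : (0 < n)%N.
Local Notation mu := (@lebesgue_rV R n).
Local Notation omega := (@ball_volume R n).

Lemma lebesgue_rV_set1_0 : mu [set 0] = 0%E.
Proof.
have -> : [set 0] = [set x : 'rV[R]_n | forall i, [set 0] (x ord0 i)].
  apply/seteqP; split => x /=; first by move=> -> i; rewrite mxE.
  by move=> x0; apply/rowP => i; rewrite x0 mxE.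
rewrite (lebesgue_rV_box (A := fun=> [set 0]))//.
rewrite (bigD1 (Ordinal n_gt0))//= lebesgue_measure_set1 mul0e//.
Qed.

Lemma ae_neq0 : {ae mu, forall x, x != 0}.
Proof.
exists [set 0]; split; [|exact: lebesgue_rV_set1_0|].
  have -> : [set 0] = (@enorm R n) @^-1` [set 0].
    apply/seteqP; split => x /=; first by move=> ->; rewrite enorm0.
    by move=> /eqP; rewrite enorm_eq0 => /eqP.
  by apply: measurable_enorm_preimage; exact: measurable_set1.
by move=> x /= /negP; rewrite negbK => /eqP.
Qed.

Variables (s q a : R).
Hypotheses (s_gt : 1 / 2 < s) (q_gt1 : 1 < q) (a_ge : - (n%:R - 1) <= a).
Local Notation alpha := (s - 1 / 2).

(** The factor 2 comes from balancing the two terms, the powers from the constants in the Hoelder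
    bound and in the bound by the weighted norm. *)
Definition strauss_const : R :=
  2 * (morrey_const n s `^ theta s q * ((2 / omega) `^ q^-1) `^ (1 - theta s q)).

Variables (f : R -> R) (D W : R).
Local Notation U := (fun x : 'rV[R]_n => f (enorm x)).
Hypothesis mf : measurable_fun setT f.
Hypothesis DE : (\int[mu]_y gagliardo_density s U y = D%:E)%E.
Hypothesis WE : (\int[mu]_x (`|U x| `^ q * enorm x `^ a)%:E = W%:E)%E.

Let mU : measurable_fun setT U.
Proof. exact: (measurableT_comp mf (@measurable_enorm R n)). Qed.

Let D_ge0 : 0 <= D.
Proof.
rewrite -lee_fin -DE; apply: integral_ge0 => y _; exact: gagliardo_density_ge0.
Qed.

Let W_ge0 : 0 <= W.
Proof.
rewrite -lee_fin -WE; apply: integral_ge0 => y _.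
by rewrite lee_fin mulr_ge0// powR_ge0.
Qed.

(** Identifies [theta] as the exponent beta/(alpha + beta) of the optimization over scales, with
    beta = 1/q. *)
Lemma theta_sigma : [/\ 0 < theta s q < 1,
  theta s q = q^-1 / (alpha + q^-1) & 1 - theta s q = alpha / (alpha + q^-1)].
Proof.
have h1 := s_gt; have h2 := q_gt1; have q0 : 0 < q by lra.
have p : 2 < 2 * s * q + 2 - q by nra.
have p' : 0 < alpha + q^-1 by rewrite addr_gt0 ?invr_gt0 ?subr_gt0.
have E : theta s q = q^-1 / (alpha + q^-1).
  rewrite /theta; field; rewrite !gt_eqF//=; nra.
split => //; last by rewrite E; field; rewrite gt_eqF//=; lra.
apply/andP; split; first by rewrite divr_gt0//; lra.
by rewrite ltr_pdivrMr; lra.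
Qed.

Let ae_density : {ae mu, forall y, (gagliardo_density s U y < +oo)%E}.
Proof.
have mg := measurable_gagliardo_density s mU.
have : mu.-integrable setT (gagliardo_density s U).
  apply/integrableP; split => //.
  under eq_integral => y _ do rewrite gee0_abs ?gagliardo_density_ge0//.
  by rewrite DE ltry.
move=> /integrable_ae => /(_ measurableT); apply: filterS => y /(_ I).
by rewrite ge0_fin_numE// gagliardo_density_ge0.
Qed.

Lemma strauss_profile : exists w : R -> R,
  [/\ forall r r', 0 < r -> r < r' -> `|w r - w r'| <=
        morrey_const n s * Num.sqrt (D / r ^+ n.-1) * (r' - r) `^ alpha,
      {ae mu, forall x, U x = w (enorm x)}
    & forall r, 0 < r -> `|w r| <= strauss_const * r `^ (- sigma n s q a) *
        (Num.sqrt D `^ theta s q * (W `^ q^-1) `^ (1 - theta s q))].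
Proof.
have [w [wh wU]] := radial_profile n_gt0 s_gt mf DE.
have aeU : {ae mu, forall x, U x = w (enorm x)}.
  by apply: filterS2 ae_neq0 ae_density => y; exact: wU.
exists w; split => // r r0.
have w0 := ball_volume_gt0 (R := R) n_gt0.
have q0 : 0 < q by move: q_gt1 => h; lra.
have al0 : 0 < alpha by rewrite subr_gt0.
have K0 := morrey_const_ge0 n s_gt.
(* Joint exponent of the volume of an annulus and of the weight; the lower bound on [a] makes it
   nonnegative. *)
pose k := n%:R - 1 + a.
have k0 : 0 <= k by move: a_ge; rewrite /k => h; lra.
have nE : n%:R - 1 = n.-1%:R :> R.
  by rewrite -[in LHS](prednK n_gt0) -natr1 addrK.
have point d : 0 < d -> `|w r| <= morrey_const n s * Num.sqrt (D / r ^+ n.-1) * d `^ alpha +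
    (2 / omega * (W / r `^ k)) `^ q^-1 * d `^ (- q^-1).
  move=> d0; have rd : 0 <= r + d / 2 by lra.
  pose A : set 'rV[R]_n := annulus (r + d / 2) (r + d).
  have mA : measurable A by exact: measurable_annulus.
  have lowA : ((d / 2 * (r + d) ^+ n.-1 * omega)%:E <= mu A)%E.
    have := lebesgue_rV_annulus_ge n_gt0 rd (_ : r + d / 2 <= r + d).
    have -> : r + d - (r + d / 2) = d / 2 by lra.
    by apply; lra.
  have pos : 0 < d / 2 * (r + d) ^+ n.-1 * omega.
    by rewrite !mulr_gt0 ?exprn_gt0//; lra.
  have Afin : (0 < mu A < +oo)%E.
    by rewrite (lt_le_trans _ lowA) ?lte_fin//= lebesgue_rV_annulus ?ltry//; lra.
  pose h (x : 'rV[R]_n) := (`|U x| `^ q * enorm x `^ a)%:E.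
  have h0 x : (0 <= h x)%E by rewrite lee_fin mulr_ge0 ?powR_ge0.
  have mh : measurable_fun setT h by exact: measurable_weighted.
  have hA : (\int[mu]_(x in A) h x <= W%:E)%E.
    by rewrite -WE; apply: ge0_subset_integral.
  (* A single point serves twice: [U] agrees with [w] there, and the weighted integrand is at most
     its mean. *)
  have [y [/= /andP[ya yb] yE hy]] : exists y, [/\ A y, U y = w (enorm y) &
      (mu A * h y <= \int[mu]_(x in A) h x)%E].
    apply: exists_le_average => //; first exact: measurable_funTS.
    by apply: (le_lt_trans hA); rewrite ltry.
  have wy : `|w (enorm y)| <= (2 / omega * (W / r `^ k)) `^ q^-1 * d `^ (- q^-1).
    have {}hy : d / 2 * (r + d) ^+ n.-1 * omega * (`|w (enorm y)| `^ q * enorm y `^ a) <= W.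
      rewrite -lee_fin; apply: le_trans hA; apply: le_trans hy.
      by rewrite EFinM /h yE lee_wpmul2r// lee_fin mulr_ge0 ?powR_ge0.
    have y0 : 0 < enorm y by lra.
    (* The weight alone decreases in |y| when a < 0, so it is joined to the volume factor before |y|
       is compared with r. *)
    have rk : r `^ k <= (r + d) ^+ n.-1 * enorm y `^ a.
      apply: (@le_trans _ _ (enorm y `^ k)).
        by apply: ge0_ler_powR; rewrite ?nnegrE//; lra.
      rewrite /k powRD; last by rewrite (gt_eqF y0) implybT.
      rewrite ler_wpM2r ?powR_ge0// nE powR_mulrn ?(ltW y0)//.
      by rewrite lerXn2r ?nnegrE; lra.
    have : `|w (enorm y)| `^ q <= 2 / omega * (W / r `^ k) / d.
      have -> : 2 / omega * (W / r `^ k) / d = W / (d / 2 * omega * r `^ k).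
        by field; rewrite !gt_eqF// powR_gt0.
      rewrite ler_pdivlMr; last by rewrite !mulr_gt0 ?powR_gt0//; lra.
      apply: le_trans hy.
      have -> : d / 2 * (r + d) ^+ n.-1 * omega * (`|w (enorm y)| `^ q * enorm y `^ a) =
        `|w (enorm y)| `^ q * (d / 2 * omega * ((r + d) ^+ n.-1 * enorm y `^ a)) by ring.
      rewrite ler_wpM2l ?powR_ge0// ler_wpM2l// mulr_ge0; lra.
    move=> hw; have qV : 0 <= q^-1 by rewrite invr_ge0 ltW.
    have rhs0 : 0 <= 2 / omega * (W / r `^ k) / d.
      by rewrite !mulr_ge0 ?invr_ge0 ?powR_ge0 ?(ltW w0) ?(ltW d0).
    have {hw} := ge0_ler_powR qV (powR_ge0 _ _ : _ \in Num.nneg) (rhs0 : _ \in Num.nneg) hw.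
    rewrite -powRrM divff ?gt_eqF// powRr1// => /le_trans; apply.
    rewrite powRM ?invr_ge0 ?mulr_ge0 ?invr_ge0 ?powR_ge0 ?(ltW w0) ?(ltW d0)//.
    by rewrite -(powR_inv1 (ltW d0)) -powRrM mulN1r.
  have -> : w r = (w r - w (enorm y)) + w (enorm y) by ring.
  apply: (le_trans (ler_normD _ _)); rewrite lerD//.
  apply: (le_trans (wh r (enorm y) r0 _)); first by lra.
  apply: ler_wpM2l; first by rewrite mulr_ge0 ?sqrtr_ge0.
  by apply: ge0_ler_powR; rewrite ?nnegrE ?(ltW al0)//; lra.
have [_ thE th1E] := theta_sigma.
have qV0 : 0 < q^-1 by rewrite invr_gt0.
have Aq0 : 0 <= morrey_const n s * Num.sqrt (D / r ^+ n.-1).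
  by rewrite mulr_ge0 ?sqrtr_ge0.
have := le_scale_optimum al0 qV0 Aq0 (powR_ge0 _ _) point.
rewrite -thE -th1E => /le_trans; apply.
have -> : Num.sqrt (D / r ^+ n.-1) = Num.sqrt D * r `^ (- ((n%:R - 1) / 2)).
  rewrite sqrtrM//; congr (_ * _).
  rewrite -powR12_sqrt ?invr_ge0 ?exprn_ge0 ?(ltW r0)//.
  rewrite -powR_mulrn ?(ltW r0)// -powRN -powRrM nE; congr (_ `^ _); ring.
have -> : (2 / omega * (W / r `^ k)) `^ q^-1 =
   (2 / omega) `^ q^-1 * (W `^ q^-1 * r `^ (- (k / q))).
  rewrite powRM ?divr_ge0 ?powR_ge0 ?(ltW w0)//; congr (_ * _).
  rewrite powRM ?invr_ge0 ?powR_ge0//; congr (_ * _).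
  by rewrite -powRN -powRrM mulNr.
rewrite (@powRM _ (morrey_const n s) _ _ K0); last first.
  by rewrite mulr_ge0 ?sqrtr_ge0 ?powR_ge0.
rewrite (@powRM _ (Num.sqrt D)) ?sqrtr_ge0 ?powR_ge0//.
rewrite (@powRM _ ((2 / omega) `^ q^-1)) ?mulr_ge0 ?powR_ge0//.
rewrite (@powRM _ (W `^ q^-1)) ?powR_ge0//.
have -> : r `^ (- sigma n s q a) = (r `^ (- ((n%:R - 1) / 2))) `^ theta s q *
   (r `^ (- (k / q))) `^ (1 - theta s q).
  rewrite -!powRrM -powRD; last by rewrite (gt_eqF r0) implybT.
  congr (_ `^ _); rewrite /sigma -/k.
  have exponent (t x y : R) : - (t * x + (1 - t) * y) = - x * t + - y * (1 - t).
    by ring.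
  exact: exponent.
have regroup (x1 x2 x3 x4 x5 x6 : R) : 2 * ((x1 * (x2 * x3)) * (x4 * (x5 * x6))) =
  2 * (x1 * x4) * (x3 * x6) * (x2 * x5) by ring.
by rewrite /strauss_const regroup.
Qed.

End strauss.

(** * Measurable radial representatives *)

Section null_sections.
Context d1 d2 (T1 : measurableType d1) (T2 : measurableType d2) (R : realType).
Variables (m1 : {sigma_finite_measure set T1 -> \bar R})
          (m2 : {sigma_finite_measure set T2 -> \bar R}).
Variable P : set (T1 * T2).
Hypothesis mP : measurable P.
Local Open Scope ereal_scope.

Let h (p : T1 * T2) : \bar R := (\1_P p)%:E.

Let mh : measurable_fun setT h.
Proof. by apply/measurable_EFinP; exact: measurable_indic. Qed.

Let h0 p : 0 <= h p. Proof. by rewrite lee_fin. Qed.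

Let hx x : \int[m2]_y h (x, y) = m2 (xsection P x).
Proof.
rewrite -[xsection P x]setIT -integral_indic//; last exact: measurable_xsection.
by apply: eq_integral => y _; rewrite /h !indicE mem_xsection.
Qed.

Let hy y : \int[m1]_x h (x, y) = m1 (ysection P y).
Proof.
rewrite -[ysection P y]setIT -integral_indic//; last exact: measurable_ysection.
by apply: eq_integral => x _; rewrite /h !indicE mem_ysection.
Qed.

Let ae_zero d (T : measurableType d) (m : {measure set T -> \bar R}) (g : T -> \bar R) :
  measurable_fun setT g -> (forall x, 0 <= g x) -> \int[m]_x g x = 0 ->
  {ae m, forall x, g x = 0}.
Proof.
move=> mg g0 Ig; have : \int[m]_x `|g x| = 0.
  by rewrite -Ig; apply: eq_integral => x _; rewrite gee0_abs.
by move/(ae_eq_integral_abs _ measurableT mg); apply: filterS => x; exact.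
Qed.

(** Tonelli for the indicator of [P]: a vanishing double integral makes almost every section in the
    other direction null. *)
Lemma null_ysection : (forall x, m2 (xsection P x) = 0) ->
  {ae m2, forall y, m1 (ysection P y) = 0}.
Proof.
move=> P0; have E := fubini_tonelli (m1 := m1) (m2 := m2) h mh h0.
have : {ae m2, forall y, \int[m1]_x h (x, y) = 0}.
  apply: ae_zero; first exact: (measurable_fun_fubini_tonelli_G (m1 := m1) h mh h0).
    by move=> y; exact: integral_ge0.
  by rewrite -E integral0_eq// => x _; rewrite hx P0.
by apply: filterS => y; rewrite hy.
Qed.

Lemma null_xsection : (forall y, m1 (ysection P y) = 0) ->
  {ae m1, forall x, m2 (xsection P x) = 0}.
Proof.
move=> P0; have E := fubini_tonelli (m1 := m1) (m2 := m2) h mh h0.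
have : {ae m1, forall x, \int[m2]_y h (x, y) = 0}.
  apply: ae_zero; first exact: (measurable_fun_fubini_tonelli_F (m2 := m2) h mh h0).
    by move=> x; exact: integral_ge0.
  by rewrite E integral0_eq// => y _; rewrite hy P0.
by apply: filterS => x; rewrite hx.
Qed.

End null_sections.

Section radial_modification.
Context {R : realType}.
Variable n : nat.
Hypothesis n_gt0 : (0 < n)%N.
Local Notation mu := (@lebesgue_rV R n).
Local Notation leb := (@lebesgue_measure R).

Lemma ae_exists d (T : measurableType d) (m : {measure set T -> \bar R})
    (A : set T) (P : T -> Prop) : measurable A -> (0 < m A < +oo)%E ->
  {ae m, forall x, P x} -> exists2 x, A x & P x.
Proof.
move=> mA A0 Px.
have [||x [Ax Px' _]] := exists_le_average (h := cst 0%E) mA A0 Px _ (fun=> lexx 0%E).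
- exact: measurable_cst.
- by rewrite integral0.
- by exists x.
Qed.

Lemma measurable_set_gt0 d (T : measurableType d) (g : T -> R) :
  measurable_fun setT g -> measurable [set x | 0 < g x].
Proof.
move=> mg; have -> : [set x | 0 < g x] = g @^-1` `]0, +oo[%classic.
  by apply/seteqP; split => p /=; rewrite in_itv/= andbT.
by rewrite -[X in measurable X]setTI; apply: mg => //; exact: measurable_itv.
Qed.

Lemma measurable_scale_pair :
  measurable_fun setT (fun p : measurableTypeR R * 'rV[R]_n => p.1 *: p.2).
Proof.
apply: measurable_fun_rVP => i; under eq_fun do rewrite !mxE.
apply: measurable_funM; first exact: measurable_fst.
exact: (measurableT_comp (measurable_coord i) measurable_snd).
Qed.

Lemma measurable_ray (x0 : 'rV[R]_n) (k : R) :
  measurable_fun [set: R] (fun r : R => (r * k) *: x0).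
Proof.
apply: measurable_fun_rVP => i; under eq_fun do rewrite !mxE.
by do 2 apply: measurable_funM => //.
Qed.

(** The pairs (t, x) with |t x| in [Z] are examined in both directions. For fixed x the t form a
    dilate of [Z], which is null; so for almost every t the x form a null set, and one such t in (1,
    2) suffices after a dilation. *)
Lemma null_preimage_enorm (Z : set R) : measurable Z -> Z `<=` [set r | 0 < r] ->
  leb Z = 0%E -> mu ((@enorm R n) @^-1` Z) = 0%E.
Proof.
move=> mZ Zpos Z0.
pose P := [set p : measurableTypeR R * 'rV[R]_n | 0 < p.1 /\ Z (enorm (p.1 *: p.2))].
have mP : measurable P.
  apply: measurableI.
    exact: (measurable_set_gt0 (g := fst)).
  rewrite -[X in measurable X]setTI.
  have := measurableT_comp (@measurable_enorm R n) measurable_scale_pair.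
  by move=> /(_ measurableT Z mZ).
have : {ae (leb : {sigma_finite_measure set (measurableTypeR R) -> \bar R}),
    forall t, mu (xsection P t) = 0%E}.
  apply: null_xsection => // x.
  have [->|x0] := eqVneq x 0.
    rewrite (_ : ysection P 0 = set0) ?measure0//.
    apply/seteqP; split => // t; rewrite /ysection/= inE /P/= => -[_].
    by rewrite scaler0 enorm0 => /Zpos/=; rewrite ltxx.
  rewrite -enorm_gt0 in x0.
  apply/eqP; rewrite eq_le measure_ge0 andbT.
  have := lebesgue_measure_affine 0 x0 mZ; rewrite Z0 => /esym/eqP.
  rewrite mule_eq0 eqe (gt_eqF x0)/= => /eqP <-.
  apply: le_measure; rewrite ?inE.
  - exact: measurable_ysection.
  - have mf : measurable_fun [set: R] (fun t : R => enorm x * t + 0).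
      by apply: measurable_funD => //; exact: measurable_funM.
    by rewrite -[X in measurable X]setTI; exact: mf.
  - move=> t; rewrite /ysection/= inE /P/= => -[t0].
    by rewrite enormZ gtr0_norm// addr0 mulrC.
move=> /(ae_exists (A := (`]1, 2[%classic : set (measurableTypeR R)))) [||t].
- exact: measurable_itv.
- suff : (0 < leb `]1%R, 2%R[%classic < +oo)%E by [].
  by rewrite lebesgue_measure_itv/= lte_fin ltr1n -EFinB lte_fin ltry andbT; lra.
rewrite /= in_itv/= => /andP[t1 _] Pt; have t0 : 0 < t by lra.
have mE : measurable ((@enorm R n) @^-1` Z) by exact: measurable_enorm_preimage.
rewrite (lebesgue_rV_affine 0 t0 mE).
have {}Pt : mu (xsection P t) = 0%E := Pt.
rewrite [X in (_ * mu X)%E](_ : _ = xsection P t) ?Pt ?mule0//.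
apply/seteqP; split => x; rewrite /xsection/= inE /P/= addr0; first by [].
by case.
Qed.

(** By Tonelli, almost every ray meets the exceptional set [N] in a null set of parameters. The
    restriction of [u] to one such ray is a measurable profile, and it agrees with the given one for
    almost every radius. *)
Lemma radial_measurable_profile (u : 'rV[R]_n -> R) : measurable_fun setT u -> radial u ->
  exists f : R -> R, measurable_fun setT f /\ {ae mu, forall x, u x = f (enorm x)}.
Proof.
move=> mu_ [f0 [N [mN N0 uN]]].
pose P := [set p : measurableTypeR R * 'rV[R]_n | 0 < p.1 /\ N (p.1 *: p.2)].
have mP : measurable P.
  apply: measurableI.
    exact: (measurable_set_gt0 (g := fst)).
  by rewrite -[X in measurable X]setTI; exact: measurable_scale_pair.
have : {ae mu, forall x, (leb : {sigma_finite_measure set (measurableTypeR R) -> \bar R})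
    (ysection P x) = 0%E}.
  apply: null_ysection => // t; apply/eqP; rewrite eq_le measure_ge0 andbT.
  have [t0|t0] := leP t 0.
    rewrite (_ : xsection P t = set0) ?measure0//.
    apply/seteqP; split => // x; rewrite /xsection/= inE /P/= => -[].
    by rewrite ltNge t0.
  have := lebesgue_rV_affine 0 t0 mN; rewrite N0 => /esym/eqP.
  rewrite mule_eq0 eqe expf_eq0 (gt_eqF t0) andbF/= => /eqP <-.
  apply: le_measure; rewrite ?inE.
  - exact: measurable_xsection.
  - by rewrite -[X in measurable X]setTI; exact: measurable_affine.
  - by move=> x; rewrite /xsection/= inE /P/= addr0 => -[].
move=> /(ae_exists (A := annulus 1 2)) [||x0].
- exact: measurable_annulus.
- have := lebesgue_rV_annulus_ge (R := R) n_gt0 ler01 (ler1n R 2).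
  have pos : 0 < (2 - 1) * 2 ^+ n.-1 * ball_volume n :> R.
    by rewrite !mulr_gt0 ?exprn_gt0 ?ball_volume_gt0//; lra.
  move=> h; apply/andP; split; first by apply: lt_le_trans h; rewrite lte_fin.
  have E := lebesgue_rV_annulus n_gt0 (ler01 : 0 <= 1 :> R) (ler1n R 2).
  suff : (mu (annulus 1 2) < +oo)%E by [].
  by rewrite E ltry.
rewrite /annulus/= => /andP[x01 _] Px0; have x0gt : 0 < enorm x0 by lra.
pose k := (enorm x0)^-1; have kgt : 0 < k by rewrite invr_gt0.
exists (fun r => u ((r * k) *: x0)); split.
  exact: (measurableT_comp mu_ (measurable_ray x0 k)).
pose Z := [set r : R | 0 < r /\ N ((r * k) *: x0)].
have mZ : measurable Z.
  apply: measurableI.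
    exact: (measurable_set_gt0 (g := id)).
  by rewrite -[X in measurable X]setTI; exact: (measurable_ray x0 k).
have Z0 : leb Z = 0%E.
  (* [Z] is the section of [P] at [x0], dilated by |x0|. *)
  rewrite (lebesgue_measure_affine 0 x0gt mZ).
  have {}Px0 : leb (ysection P x0) = 0%E := Px0.
  rewrite [X in (_ * leb X)%E](_ : _ = ysection P x0) ?Px0 ?mule0//.
  apply/seteqP; split => t; rewrite /ysection/= inE /Z/P/= addr0 pmulr_rgt0//;
    by rewrite mulrAC /k mulfV ?gt_eqF// mul1r.
have Znull := null_preimage_enorm mZ (fun r => @proj1 _ _) Z0.
have aeZ : {ae mu, forall x, ~ Z (enorm x)}.
  exists ((@enorm R n) @^-1` Z); split => //; first exact: measurable_enorm_preimage.
  by move=> x /= /contrapT.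
have aeN : {ae mu, forall x, ~ N x} by exists N; split => // x /= nNx; apply: contrapT.
apply: filterS3 aeZ aeN (ae_neq0 n_gt0) => x Zx Nx x_neq0.
rewrite -enorm_gt0 in x_neq0.
have good y : ~ N y -> u y = f0 (enorm y).
  by move=> Ny; apply: contrapT => uy; apply: Ny; exact: uN.
(* Both x and the point of norm |x| on the chosen ray avoid [N], so [u] takes the value f0(|x|) at
   both. *)
rewrite good// good; last by move=> Ny; apply: Zx; split.
by rewrite enormZ gtr0_norm ?mulr_gt0// /k divfK ?gt_eqF.
Qed.

End radial_modification.

(** * Power integrals and the normalization constant *)

Section self_similar_integral.
Context {R : realType}.
Variable n : nat.
Local Notation mu := (@lebesgue_rV R n).
Local Open Scope ereal_scope.

Lemma measurable_enorm_powR (p : R) :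
  measurable_fun setT (fun x : 'rV[R]_n => (enorm x `^ p)%:E).
Proof.
apply/measurable_EFinP.
exact: (measurableT_comp (@measurable_powR R _) (@measurable_enorm R n)).
Qed.

Lemma integral_enorm_powR_scale (A : set 'rV[R]_n) (t p : R) : (0 < t)%R ->
  measurable A ->
  \int[mu]_(x in [set x | A (t^-1 *: x)%R]) (enorm x `^ p)%:E =
  (t ^+ n * t `^ p)%:E * \int[mu]_(x in A) (enorm x `^ p)%:E.
Proof.
move=> t0 mA; have t0' : (0 < t^-1)%R by rewrite invr_gt0.
have mB : measurable [set x | A (t^-1 *: x)%R].
  rewrite -[X in measurable X]setTI.
  have := measurable_affine t^-1 (0 : 'rV[R]_n) => /(_ measurableT A mA).
  by under [X in _ `&` X]eq_set do rewrite addr0.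
rewrite integral_mkcond (ge0_integral_affine 0 t0); last 2 first.
- exact: ((measurable_restrictT _ mB).1 (measurable_funTS (measurable_enorm_powR p))).
- by apply: erestrict_ge0 => x _; rewrite lee_fin powR_ge0.
rewrite (integral_mkcond A) EFinM -muleA; congr (_ * _).
rewrite -ge0_integralZl_EFin ?powR_ge0//; last 2 first.
- by move=> x _; apply: erestrict_ge0 => {}x _; rewrite lee_fin powR_ge0.
- exact: ((measurable_restrictT _ mA).1 (measurable_funTS (measurable_enorm_powR p))).
apply: eq_integral => x _; rewrite addr0 !patchE.
have -> : (t *: x)%R \in [set x | A (t^-1 *: x)%R] = (x \in A).
  have tK : (t^-1 *: (t *: x) = x)%R by rewrite scalerA mulVf ?gt_eqF// scale1r.
  by apply/idP/idP => /set_mem/= h; apply/mem_set; move: h; rewrite /= tK.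
by case: ifP => _; rewrite ?mule0// enormZ gtr0_norm// powRM ?enorm_ge0 ?(ltW t0)// EFinM.
Qed.

(* [F] exhausts a set built from a base piece and its dilates by [t]; the
   integrals of [|x|^p] over [F k] obey [I(k+1) <= D + t^(n+p) I(k)]. *)
Lemma self_similar_lty (F : nat -> set 'rV[R]_n) (A : set 'rV[R]_n) (t p : R) :
  (0 < t)%R -> (t ^+ n * t `^ p < 1)%R -> measurable A ->
  (forall k, measurable (F k)) -> {homo F : k m / (k <= m)%N >-> k `<=` m} ->
  F 0%N = set0 ->
  (forall k, F k.+1 `<=` A `|` [set x | F k (t^-1 *: x)%R]) ->
  \int[mu]_(x in A) (enorm x `^ p)%:E < +oo ->
  \int[mu]_(x in \bigcup_k F k) (enorm x `^ p)%:E < +oo.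
Proof.
move=> t0 l1 mA mF ndF F0 FS Aoo.
set l := (t ^+ n * t `^ p)%R in l1.
have l0 : (0 <= l)%R by rewrite mulr_ge0 ?exprn_ge0 ?powR_ge0 ?ltW.
have h0 (x : 'rV[R]_n) : 0 <= (enorm x `^ p)%:E by rewrite lee_fin powR_ge0.
have mh := measurable_enorm_powR p.
pose D := fine (\int[mu]_(x in A) (enorm x `^ p)%:E).
have DE : \int[mu]_(x in A) (enorm x `^ p)%:E = D%:E.
  by rewrite fineK// ge0_fin_numE// integral_ge0.
have D0 : (0 <= D)%R by rewrite -lee_fin -DE integral_ge0.
(* The bound is the fixed point of I -> D + l I, hence preserved by the recursion. *)
have bound k : \int[mu]_(x in F k) (enorm x `^ p)%:E <= (D / (1 - l))%:E.
  elim: k => [|k ih].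
    by rewrite F0 integral_set0 lee_fin divr_ge0// subr_ge0 ltW.
  pose B := [set x | F k (t^-1 *: x)%R].
  have mB : measurable B.
    rewrite -[X in measurable X]setTI.
    have := measurable_affine t^-1 (0 : 'rV[R]_n) => /(_ measurableT _ (mF k)).
    by under [X in _ `&` X]eq_set do rewrite addr0.
  apply: (@le_trans _ _ (\int[mu]_(x in A `|` B) (enorm x `^ p)%:E)).
    apply: ge0_subset_integral => //; first exact: measurableU.
    exact: measurable_funTS.
  apply: (@le_trans _ _ (\int[mu]_(x in A) (enorm x `^ p)%:E +
                         \int[mu]_(x in B) (enorm x `^ p)%:E)).
    have -> : A `|` B = A `|` (B `\` A).
      apply/seteqP; split => x [Ax|Bx]; [by left| |by left|by right; case: Bx].
      by have [Ax|nAx] := pselect (A x); [left|right].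

    rewrite ge0_integral_setU//; last 3 first.
    - exact: measurableD.
    - exact: measurable_funTS.
    - by rewrite disj_set2E setDIK.
    rewrite leeD2l//; apply: ge0_subset_integral => //; first exact: measurableD.
    exact: measurable_funTS.
  rewrite integral_enorm_powR_scale// DE.
  apply: (@le_trans _ _ (D%:E + l%:E * (D / (1 - l))%:E)).
    by rewrite leeD2l// lee_wpmul2l.
  rewrite -EFinM -EFinD lee_fin le_eqVlt; apply/orP; left; apply/eqP.
  by field; rewrite subr_eq0 gt_eqF.
have ndF' : nondecreasing_seq F by move=> i j ij; rewrite subsetEset; exact: ndF.
have mhF i : measurable_fun (F i) (fun x => (enorm x `^ p)%:E) by exact: measurable_funTS.
have cvgF := ge0_nondecreasing_set_cvg_integral (mu := mu) ndF' mF mhF (fun _ _ _ => h0 _).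
rewrite -(cvg_lim _ cvgF)//.
apply: (@le_lt_trans _ _ (D / (1 - l))%:E); last exact: ltry.
apply: lime_le; last by apply: nearW.
by apply/cvg_ex; eexists; exact: cvgF.
Qed.

End self_similar_integral.

Section power_integrals.
Context {R : realType}.
Variable n : nat.
Hypothesis n_gt0 : (0 < n)%N.
Local Notation mu := (@lebesgue_rV R n).

Let annulus_powR_lty (a b p : R) : 0 < a -> a <= b ->
  (\int[mu]_(x in annulus a b) (enorm x `^ p)%:E < +oo)%E.
Proof.
move=> a0 ab; have b0 := lt_le_trans a0 ab.
have mA : measurable (annulus a b : set 'rV[R]_n) by exact: measurable_annulus.
(* The sum of the two end values bounds |x|^p for either sign of p. *)
apply: (@le_lt_trans _ _ (\int[mu]_(x in annulus a b) (cst (a `^ p + b `^ p)%:E x))%E).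
  apply: ge0_le_integral => //.
  - by move=> x _; rewrite lee_fin powR_ge0.
  - exact: measurable_funTS (measurable_enorm_powR p).
  - move=> x; rewrite /annulus/= => /andP[ax xb]; rewrite lee_fin.
    have [p0|p0] := leP 0 p.
      rewrite ler_wpDl ?powR_ge0//.
      by apply: ge0_ler_powR; rewrite ?nnegrE ?enorm_ge0 ?(ltW b0) ?(ltW xb).
    apply: ler_wpDr; first exact: powR_ge0.
    have -> : p = - (- p) by rewrite opprK.
    rewrite !(powRN _ (- p)) lef_pV2 ?posrE ?powR_gt0//; last exact: lt_le_trans ax.
    apply: ge0_ler_powR; rewrite ?nnegrE ?enorm_ge0 ?(ltW a0)//.
    by rewrite oppr_ge0 ltW.
by rewrite integral_cst//= lebesgue_rV_annulus ?(ltW a0)// ltry.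
Qed.

Let half_power_lt1 (p : R) : 0 < p -> (2^-1 : R) `^ p < 1.
Proof.
by move=> p0; rewrite -powR_inv1// -powRrM mulN1r powR2N_lt1.
Qed.

(** Dilation by 1/2 multiplies the integral by 2^(-(n + p)), a ratio below 1; the shells 2^(-k) <=
    |x| < 1 exhaust the ball up to the origin, which is null. *)
Lemma ball_powR_lty (p : R) : - n%:R < p ->
  (\int[mu]_(x in [set x | (enorm x < 1)%R]) (enorm x `^ p)%:E < +oo)%E.
Proof.
move=> np.
pose F k : set 'rV[R]_n := annulus (2^-1 ^+ k) 1.
have h2 : 0 < 2^-1 :> R by rewrite invr_gt0.
have UF : \bigcup_k F k = [set x | enorm x < 1] `\` [set 0].
  apply/seteqP; split => x /=.
    move=> [k _]; rewrite /F /annulus/= => /andP[xk x1]; split => // x0.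
    by move: xk; rewrite x0 enorm0 leNgt exprn_gt0.
  move=> [x1 /eqP]; rewrite -enorm_gt0 => x0.
  exists (Num.truncn (enorm x)^-1) => //; rewrite /F /annulus/= x1 andbT.
  rewrite exprVn -[leRHS]invrK lef_pV2 ?posrE ?invr_gt0 ?exprn_gt0//.
  apply: le_trans (ltW (truncnS_gt _)) _.
  by rewrite -natrX ler_nat ltn_expl.
have mF k : measurable (F k) by exact: measurable_annulus.
rewrite (ge0_negligible_integral _ _ _ _ (lebesgue_rV_set1_0 n_gt0)); last 4 first.
- rewrite -[X in measurable X]setCK; apply: measurableC.
  have -> : ~` [set 0] = [set x : 'rV[R]_n | 0 < enorm x].
    by apply/seteqP; split => x /=; rewrite enorm_gt0 => /eqP.
  exact: (measurable_set_gt0 (@measurable_enorm R n)).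
- exact: measurable_ball_enorm.
- exact: measurable_funTS (measurable_enorm_powR p).
- by move=> x _; rewrite lee_fin powR_ge0.
rewrite -UF; apply: (@self_similar_lty _ _ F (annulus 2^-1 1) 2^-1) => //.
- rewrite -powR_mulrn ?ltW// -powRD; last by rewrite (gt_eqF h2) implybT.
  by apply: half_power_lt1; lra.
- exact: measurable_annulus.
- move=> k m km x; rewrite /F /annulus/= => /andP[xk ->]; rewrite andbT.
  by apply: le_trans xk; apply: ler_wiXn2l => //; lra.
- apply/seteqP; split => // x; rewrite /F /annulus/= expr0 => /andP[].
  by rewrite leNgt => /negbTE ->.
- move=> k x; rewrite /F /annulus/= => /andP[xk x1].
  have [xh|xh] := leP 2^-1 (enorm x); first by left; apply/andP.
  right; rewrite /= invrK enormZ gtr0_norm//; apply/andP; split; last by lra.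
  by move: xk; rewrite exprS; lra.
- by apply: annulus_powR_lty => //; lra.
Qed.

(** As for the ball, with dilation by 2 and ratio 2^(n + p), now below 1. *)
Lemma coball_powR_lty (p : R) : p < - n%:R ->
  (\int[mu]_(x in [set x | (1 <= enorm x)%R]) (enorm x `^ p)%:E < +oo)%E.
Proof.
move=> np.
pose F k : set 'rV[R]_n := annulus 1 (2 ^+ k).
have UF : \bigcup_k F k = [set x | 1 <= enorm x].
  apply/seteqP; split => x /=; first by move=> [k _]; rewrite /F /annulus/= => /andP[].
  move=> x1; exists (Num.truncn (enorm x)).+1 => //; rewrite /F /annulus/= x1 /=.
  apply: lt_le_trans (truncnS_gt _) _.
  by rewrite -natrX ler_nat ltnW// ltn_expl.
have mF k : measurable (F k) by exact: measurable_annulus.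
rewrite -UF; apply: (@self_similar_lty _ _ F (annulus 1 2) 2) => //.
- rewrite -powR_mulrn// -powRD; last by rewrite pnatr_eq0 implybT.
  have -> : n%:R + p = - (- (n%:R + p)) by rewrite opprK.
  rewrite powRN -powR_inv1 ?powR_ge0// -powRrM mulrC powRrM powR_inv1//.
  by apply: half_power_lt1; lra.
- exact: measurable_annulus.
- move=> k m km x; rewrite /F /annulus/= => /andP[-> xk]/=.
  by apply: lt_le_trans xk _; apply: ler_weXn2l => //; lra.
- apply/seteqP; split => // x; rewrite /F /annulus/= expr0 => /andP[].
  by rewrite leNgt => /negbTE ->.
- move=> k x; rewrite /F /annulus/= => /andP[x1 xk].
  have [xh|xh] := ltP (enorm x) 2; first by left; apply/andP.
  right; rewrite /= enormZ gtr0_norm ?invr_gt0//; apply/andP; split; first by lra.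
  by move: xk; rewrite exprS; lra.
- by apply: annulus_powR_lty => //; lra.
Qed.

(** Integrable majorant, as for Levy measures, both of the integrand of C(n,s) and of the Gagliardo
    kernel of a test function, up to constants. *)
Definition levy_density (s : R) (z : 'rV[R]_n) : R :=
  Num.min 1 (enorm z ^+ 2) / enorm z `^ (n%:R + 2 * s).

Lemma levy_density_ge0 s z : 0 <= levy_density s z.
Proof. by rewrite divr_ge0 ?powR_ge0// le_min ler01 exprn_ge0// enorm_ge0. Qed.

Lemma measurable_levy_density s : measurable_fun setT (levy_density s).
Proof.
apply: measurable_funM.
  apply: measurable_minr => //; apply: measurable_funX; exact: measurable_enorm.
under eq_fun do rewrite -powRN.
exact: (measurableT_comp (@measurable_powR R _) (@measurable_enorm R n)).
Qed.

(** Near 0 the exponent 2 - (n + 2s) exceeds -n because s < 1; at infinity -(n + 2s) is below -n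
    because s > 0. *)
Lemma levy_density_lty s : 0 < s < 1 ->
  (\int[mu]_z (levy_density s z)%:E < +oo)%E.
Proof.
move=> /andP[s0 s1].
have mB : measurable [set x : 'rV[R]_n | enorm x < 1] by exact: measurable_ball_enorm.
have CB : ~` [set x : 'rV[R]_n | enorm x < 1] = [set x | 1 <= enorm x].
  by apply/seteqP; split => x /=; rewrite leNgt => /negP.
have ml : measurable_fun setT (fun z => (levy_density s z)%:E).
  by apply/measurable_EFinP; exact: measurable_levy_density.
rewrite -(setUv [set x : 'rV[R]_n | enorm x < 1]) ge0_integral_setU//; last 4 first.
- exact: measurableC.
- by rewrite setUv.
- by move=> x _; rewrite lee_fin levy_density_ge0.
- by rewrite disj_set2E setICr.
rewrite CB; apply: lte_add_pinfty.
  have p1 : - n%:R < 2 - (n%:R + 2 * s) by lra.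
  apply: le_lt_trans (ball_powR_lty p1).
  apply: ge0_le_integral => //.
  - by move=> x _; rewrite lee_fin levy_density_ge0.
  - exact: measurable_funTS.
  - exact: measurable_funTS (measurable_enorm_powR _).
  - move=> x _; rewrite lee_fin /levy_density.
    have [->|x0] := eqVneq x 0.
      by rewrite enorm0 expr0n/= (min_idPr ler01) mul0r powR_ge0.
    rewrite -enorm_gt0 in x0.
    rewrite powRB; last by rewrite (gt_eqF x0) implybT.
    rewrite ler_wpM2r ?invr_ge0 ?powR_ge0// powR_mulrn ?(ltW x0)//.
    by rewrite ge_min lexx orbT.
have p2 : - (n%:R + 2 * s) < - n%:R by lra.
apply: le_lt_trans (coball_powR_lty p2).
apply: ge0_le_integral => //.
- by rewrite -CB; exact: measurableC.
- by move=> x _; rewrite lee_fin levy_density_ge0.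
- exact: measurable_funTS.
- exact: measurable_funTS (measurable_enorm_powR _).
- move=> x _; rewrite lee_fin /levy_density powRN.
  by rewrite ler_piMl ?invr_ge0 ?powR_ge0// ge_min lexx.
Qed.

End power_integrals.

Section normalization_constant.
Context {R : realType}.

Lemma norm_sin_le (x : R) : `|sin x| <= `|x|.
Proof.
wlog x0 : x / 0 <= x.
  have [x0|x0] := leP 0 x; first exact.
  by move=> /(_ (- x)); rewrite sinN !normrN; apply; rewrite oppr_ge0 ltW.
have := @MVT_segment R sin cos 0 x x0 (fun x _ => is_derive_sin x)
  (continuous_subspaceT (@continuous_sin R)).
move=> [c _]; rewrite sin0 !subr0 => ->.
by rewrite normrM ler_piMl// cos_max.
Qed.

Lemma one_sub_cos_le (x : R) : 1 - cos x <= x ^+ 2.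
Proof.
wlog x0 : x / 0 <= x.
  have [x0|x0] := leP 0 x; first exact.
  by move=> /(_ (- x)); rewrite cosN sqrrN; apply; rewrite oppr_ge0 ltW.
have := @MVT_segment R cos (fun x => - sin x) 0 x x0 (fun x _ => is_derive_cos x)
  (continuous_subspaceT (@continuous_cos R)).
move=> [c]; rewrite in_itv/= => /andP[c0 cx]; rewrite cos0 subr0 => E.
have -> : 1 - cos x = sin c * x by lra.
rewrite expr2 ler_wpM2r//; apply: le_trans (ler_norm _) _.
by apply: le_trans (norm_sin_le _) _; rewrite ger0_norm.
Qed.

Variable n : nat.
Hypothesis n_gt0 : (0 < n)%N.
Local Notation mu := (@lebesgue_rV R n).

Let coord1E (z : 'rV[R]_n) : coord1 z = z ord0 (Ordinal n_gt0).
Proof. by case: n n_gt0 z => // m ? z; congr (z _ _); exact: val_inj. Qed.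

Let fracC_integrand (s : R) (z : 'rV[R]_n) := (1 - cos (coord1 z)) / enorm z `^ (n%:R + 2 * s).

Let fracC_integrand_ge0 s z : 0 <= fracC_integrand s z.
Proof. by rewrite divr_ge0 ?powR_ge0// subr_ge0 cos_le1. Qed.

Let measurable_fracC_integrand s : measurable_fun setT (fracC_integrand s).
Proof.
apply: measurable_funM.
  apply: measurable_funB => //.
  have mc : measurable_fun [set: R] (@cos R).
    by apply: continuous_measurable_fun; exact: continuous_cos.
  under eq_fun do rewrite coord1E.
  by apply: (measurableT_comp mc); exact: measurable_coord.
under eq_fun do rewrite -powRN.
exact: (measurableT_comp (@measurable_powR R _) (@measurable_enorm R n)).
Qed.

(** As the inverse of a [fine], [fracC] would be 0 if its integral were 0 or infinite. Finiteness
    follows from 1 - cos z_1 <= min(2, z_1^2), nonvanishing from a cube on which the integrand is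
    positive. *)
Lemma fracC_gt0 (s : R) : 0 < s < 1 -> 0 < fracC n s.
Proof.
move=> s01; rewrite /fracC invr_gt0; apply: fine_gt0.
have mI : measurable_fun setT (fun z => (fracC_integrand s z)%:E).
  by apply/measurable_EFinP; exact: measurable_fracC_integrand.
have I0 : (0 <= \int[mu]_z (fracC_integrand s z)%:E)%E.
  by apply: integral_ge0 => z _; rewrite lee_fin fracC_integrand_ge0.
apply/andP; split; last first.
  apply: (@le_lt_trans _ _ (\int[mu]_z (2%:E * (levy_density s z)%:E))%E).
    apply: ge0_le_integral => //.
    - by move=> z _; rewrite lee_fin fracC_integrand_ge0.
    - by apply: measurable_funeM; apply/measurable_EFinP; exact: measurable_levy_density.
    - move=> z _; rewrite -EFinM lee_fin /fracC_integrand /levy_density mulrA.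
      rewrite ler_wpM2r ?invr_ge0 ?powR_ge0// minr_pMr// le_min; apply/andP; split.
        by have := cos_geN1 (coord1 z); lra.
      apply: (@le_trans _ _ (coord1 z ^+ 2)); first exact: one_sub_cos_le.
      have : coord1 z ^+ 2 <= enorm z ^+ 2.
        rewrite coord1E -[leLHS]real_normK ?num_real//.
        by rewrite ler_pXn2r ?nnegrE ?enorm_ge0// enorm_coord.
      by have := sqr_ge0 (enorm z); lra.
  rewrite ge0_integralZl_EFin//; last 2 first.
  - by move=> z _; rewrite lee_fin levy_density_ge0.
  - by apply/measurable_EFinP; exact: measurable_levy_density.
  by rewrite lte_mul_pinfty ?lee_fin//; exact: levy_density_lty.
rewrite lt0e I0 andbT; apply/eqP => IE.
have : (\int[mu]_z `|(fracC_integrand s z)%:E| = 0)%E.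
  by rewrite -IE; apply: eq_integral => z _; rewrite gee0_abs ?lee_fin ?fracC_integrand_ge0.
move=> /(ae_eq_integral_abs _ measurableT mI).
(* On this cube the first coordinate lies in (1/2, 3/2), where cos is below 1. *)
have mQ : measurable (cube (const_mx 1 : 'rV[R]_n) (1 / 2)) by exact: measurable_cube.
move=> /(ae_exists mQ) [|z zQ /(_ I)].
  suff : (0 < mu (cube (const_mx 1%R : 'rV[R]_n) (1 / 2)%R) < +oo)%E by [].
  by rewrite lebesgue_rV_cube ?ltry ?andbT ?lte_fin ?exprn_gt0//; lra.
move: (zQ (Ordinal n_gt0)); rewrite mxE -coord1E /= in_itv/= => /andP[z1 z2].
have z0 : 0 < enorm z.
  have := enorm_coord z (Ordinal n_gt0); rewrite -coord1E => h.
  by have := ler_norm (coord1 z); lra.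
have : cos (coord1 z) < 1.
  have pi2 := pi_ge2 R.
  have h0 : 0 \in `[0, pi : R] by rewrite in_itv/= lexx pi_ge0.
  have h1 : coord1 z \in `[0, pi] by rewrite in_itv/=; apply/andP; split; lra.
  by rewrite -cos0 ltr_cos//; lra.
move=> cz [] /eqP; rewrite /fracC_integrand mulf_eq0 invr_eq0 gt_eqF ?subr_gt0//=.
by rewrite gt_eqF// powR_gt0.
Qed.

End normalization_constant.

(** * Finiteness on the completion *)

Section borel_rV.
Context {R : realType}.
Variable n : nat.

(** [U] is the union of the countably many cubes with rational centre and half-side 1/(k + 1) that
    it contains. *)
Lemma open_measurable_rV (U : set 'rV[R]_n) : open U -> measurable U.
Proof.
move=> oU.
pose Q (i : 'rV[rat]_n * nat) := cube (map_mx ratr i.1 : 'rV[R]_n) i.2.+1%:R^-1.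
pose F i := if pselect (Q i `<=` U) then Q i else set0.
have -> : U = \bigcup_i F i.
  apply/seteqP; split => x; last first.
    by move=> [i _]; rewrite /F; case: pselect => // QU; exact: QU.
  move=> Ux; have /nbhs_ballP[e /= e0 xU] : nbhs x U by move: oU; rewrite openE; exact.
  (* Twice the half-side is below e, so a cube with centre that close to x contains x and stays in
     the ball of radius e. *)
  pose k := Num.truncn (2 / e).
  have ke : k.+1%:R^-1 < e / 2.
    rewrite -[ltRHS]invrK ltf_pV2 ?posrE ?invr_gt0 ?divr_gt0// invf_div.
    by rewrite /k truncnS_gt.
  have k0 : 0 < k.+1%:R^-1 :> R by rewrite invr_gt0.
  move: ke k0; set d := k.+1%:R^-1 => ke k0.
  have /choice[c cP] : forall i : 'I_n, exists c : rat,
      ratr c \in `](x ord0 i - d), (x ord0 i + d)[.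
    by move=> i; apply: rat_in_itvoo; rewrite ltrBlDr -addrA ltrDl addr_gt0.
  exists (\row_i c i, k) => //; rewrite /F; case: pselect => [QU|nQU].
    move=> i; rewrite /= !mxE in_itv/= -/d.
    by have := cP i; rewrite in_itv/= => /andP[? ?]; apply/andP; split; lra.
  case: nQU => y yQ; apply: xU.
  split=> // i j; rewrite (_ : i = ord0); last by rewrite ord1.
  rewrite /ball/=.
  have := cP j; have := yQ j; rewrite /= !mxE !in_itv/= -/d => /andP[? ?] /andP[? ?].
  by rewrite ltr_norml; apply/andP; split; lra.
apply: countable_bigcupT_measurable => [|i]; first exact: countableP.
rewrite /F.
by case: pselect => QU; [exact: measurable_cube|exact: measurable0].
Qed.

Lemma continuous_measurable_rV (f : 'rV[R]_n -> R) :
  continuous f -> measurable_fun setT f.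
Proof.
move=> cf; apply: (measurability _ (RGenOpens.measurableE R)).
move=> _ [_ [a [b ->] <-]]; rewrite setTI; apply: open_measurable_rV.
by move/continuousP : cf; apply; exact: itv_open.
Qed.

End borel_rV.

Section smooth_compact_support.
Context {R : realType}.
Variable n : nat.

Lemma bounded_of_compact_support (K : set 'rV[R]_n) (g : 'rV[R]_n -> R) :
  compact K -> continuous g -> (forall x, ~ K x -> g x = 0) ->
  exists2 L, 0 <= L & forall x, `|g x| <= L.
Proof.
move=> cK cg g0.
have /compact_bounded[M [_ HM]] : compact (g @` K).
  by apply: continuous_compact => //; exact: continuous_subspaceT.
exists (`|M| + 1) => [|x]; first by rewrite addr_ge0.
have [Kx|nKx] := pselect (K x); last by rewrite g0// normr0 addr_ge0.
by apply: (HM (`|M| + 1)); [rewrite (le_lt_trans (ler_norm M))// ltrDl|exists x].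
Qed.

Variable phi : 'rV[R]_n -> R.
Hypothesis phiC : C0infty phi.

Let K := closure [set x | phi x != 0].
Local Notation e_ := (@delta_mx R 1 n ord0).

Let compactK : compact K. Proof. by case: phiC. Qed.

Let phi0 x : ~ K x -> phi x = 0.
Proof. by apply: contra_notP => /eqP phix; exact: subset_closure. Qed.

Lemma C0infty_continuous : continuous phi.
Proof. by case: phiC => /(_ 0%N) []. Qed.

Let derivable_phi i x : derivable phi x (e_ i).
Proof. by case: phiC => /(_ 1%N)[_ /(_ i)[]]. Qed.

Let continuous_dphi i : continuous (fun x => 'D_(e_ i) phi x).
Proof. by case: phiC => /(_ 1%N)[_ /(_ i)[_ []]]. Qed.

Let dphi0 i x : ~ K x -> 'D_(e_ i) phi x = 0.
Proof.
move=> nKx; rewrite (@near_eq_derive _ _ _ phi (cst 0)) ?derive_cst//.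
have : nbhs x (~` K).
  by apply: open_nbhs_nbhs; split => //; apply/closed_openC/closed_closure.
by apply: filterS => y; exact: phi0.
Qed.

Lemma C0infty_bounded : exists2 L, 0 <= L & forall x, `|phi x| <= L.
Proof. exact: bounded_of_compact_support compactK C0infty_continuous phi0. Qed.

Lemma C0infty_support : exists2 M, 0 < M & forall x, phi x != 0 -> enorm x < M.
Proof.
have /compact_bounded[M [_ HM]] := compactK.
exists (n%:R * (`|M| + 1) + 1) => [|x phix].
  by rewrite ltr_wpDl// mulr_ge0// addr_ge0.
have xM : `|x| <= `|M| + 1.
  apply: (HM (`|M| + 1)); first by rewrite (le_lt_trans (ler_norm M))// ltrDl.
  exact: subset_closure.
apply: le_lt_trans (enorm_le_mx_norm x) _.
by rewrite (le_lt_trans (ler_wpM2l _ xM))// ltrDl.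
Qed.

Let is_derive_line i x (t : R) :
  is_derive t 1 (fun t => phi (x + t *: e_ i)) ('D_(e_ i) phi (x + t *: e_ i)).
Proof.
have E : (fun h => h^-1 *: (((fun t => phi (x + t *: e_ i)) \o shift t) (h *: (1 : R)) -
    phi (x + t *: e_ i))) =
  (fun h => h^-1 *: ((phi \o shift (x + t *: e_ i)) (h *: e_ i) - phi (x + t *: e_ i))).
  apply/funext => h /=; congr (_ *: (phi _ - _)).
  by rewrite /shift/= -[h *: 1]/(h * 1) mulr1 scalerDl addrCA addrC.
have := @derivable_phi i (x + t *: e_ i); rewrite /derivable -E => d.
by apply: DeriveDef => //; rewrite /derive E.
Qed.

Let lipschitz_line i L x (t : R) : 0 <= L -> (forall y, `|'D_(e_ i) phi y| <= L) ->
  `|phi (x + t *: e_ i) - phi x| <= L * `|t|.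
Proof.
move=> L0 HL.
have gen (y : 'rV[R]_n) (r : R) : 0 <= r -> `|phi (y + r *: e_ i) - phi y| <= L * r.
  move=> r0; have [|c _] := MVT_segment r0 (fun t _ => @is_derive_line i y t).
    by apply: derivable_within_continuous => t' _; exact: (@ex_derive _ _ _ _ _ _ _
      (@is_derive_line i y t')).
  rewrite scale0r addr0 subr0 => ->; rewrite normrM (ger0_norm r0).
  by rewrite ler_wpM2r.
have [t0|t0] := leP 0 t; first by rewrite (ger0_norm t0); exact: gen.
have := gen (x + t *: e_ i) (- t); rewrite scaleNr addrK distrC (ltr0_norm t0).
by apply; rewrite oppr_ge0 ltW.
Qed.

(** One coordinate is changed at a time, with the mean value theorem on each segment; each increment
    has length at most |x - y|. *)
Lemma C0infty_lipschitz : exists2 L, 0 <= L &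
  forall x y, `|phi x - phi y| <= L * enorm (x - y).
Proof.
have /choice[L HL] : forall i, exists L, 0 <= L /\ forall x, `|'D_(e_ i) phi x| <= L.
  move=> i; have [L L0 HL] := bounded_of_compact_support compactK
    (@continuous_dphi i) (@dphi0 i).
  by exists L.
exists (\sum_(i < n) L i) => [|x y].
  by apply: sumr_ge0 => i _; case: (HL i).
pose z k := \row_(i < n) (if (i < k)%N then x ord0 i else y ord0 i).
have z0 : z 0%N = y by apply/rowP => i; rewrite mxE.
have zn : z n = x by apply/rowP => i; rewrite mxE ltn_ord.
rewrite -zn -[in X in `|_ - X|]z0 -(telescope_sumr (fun k => phi (z k)))// big_mkord.
apply: le_trans (ler_norm_sum _ _ _) _; rewrite mulr_suml; apply: ler_sum => i _.
have -> : z i.+1 = z i + (x ord0 i - y ord0 i) *: e_ i.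
  apply/rowP => j; rewrite !mxE eqxx/= ltnS leq_eqVlt -val_eqE/=.
  have [->|ij] := eqVneq j i; first by rewrite eqxx/= ltnn mulr1 addrC subrK.
  by rewrite (negbTE (ij : val j != val i)) /= mulr0 addr0.
have [L0 Li] := HL i.
apply: le_trans (lipschitz_line _ _ L0 Li) _; rewrite ler_wpM2l//.
by have := enorm_coord (x - y) i; rewrite !mxE zn.
Qed.

End smooth_compact_support.

Section domination.
Context d1 d2 (T1 : measurableType d1) (T2 : measurableType d2) (R : realType).
Variables (m1 : {sigma_finite_measure set T1 -> \bar R})
          (m2 : {sigma_finite_measure set T2 -> \bar R}).
Local Open Scope ereal_scope.

(** Over the product measure a pointwise bound is enough, with no separate argument for the inner
    integrals. *)
Lemma iterated_integral_dominated (K h1 h2 : T1 * T2 -> \bar R) (c : R) : (0 <= c)%R ->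
  measurable_fun setT K -> measurable_fun setT h1 -> measurable_fun setT h2 ->
  (forall p, 0 <= K p) -> (forall p, 0 <= h1 p) -> (forall p, 0 <= h2 p) ->
  (forall p, K p <= c%:E * (h1 p + h2 p)) ->
  \int[m2]_y \int[m1]_x h1 (x, y) < +oo -> \int[m2]_y \int[m1]_x h2 (x, y) < +oo ->
  \int[m2]_y \int[m1]_x K (x, y) < +oo.
Proof.
move=> c0 mK mh1 mh2 K0 h10 h20 Kh H1 H2.
rewrite -[X in X < _](fubini_tonelli2 (m1 := m1) (m2 := m2) K mK K0).
rewrite -[X in X < _](fubini_tonelli2 (m1 := m1) (m2 := m2) h1 mh1 h10) in H1.
rewrite -[X in X < _](fubini_tonelli2 (m1 := m1) (m2 := m2) h2 mh2 h20) in H2.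
have h120 p : 0 <= h1 p + h2 p by rewrite adde_ge0.
have mh12 : measurable_fun setT (fun p => h1 p + h2 p) by exact: emeasurable_funD.
apply: (@le_lt_trans _ _ (\int[m1 \x m2]_p (c%:E * (h1 p + h2 p)))).
  by apply: ge0_le_integral => //; exact: measurable_funeM.
rewrite ge0_integralZl_EFin// ge0_integralD//.
by rewrite lte_mul_pinfty ?lee_fin//; exact: lte_add_pinfty.
Qed.

End domination.

Section translation_kernel.
Context {R : realType}.
Variable n : nat.
Local Notation mu := (@lebesgue_rV R n).
Variables (k : 'rV[R]_n -> \bar R) (A : set 'rV[R]_n).
Hypotheses (mk : measurable_fun setT k) (k0 : forall z, (0 <= k z)%E)
  (ksym : forall z, k (- z) = k z) (koo : (\int[mu]_z k z < +oo)%E)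
  (mA : measurable A) (Aoo : (mu A < +oo)%E).
Local Open Scope ereal_scope.

Let I := \int[mu]_z k z.

Let translate (y : 'rV[R]_n) : \int[mu]_x k (x - y)%R = I.
Proof.
rewrite /I (ge0_integral_affine (- y)%R ltr01 mk k0) expr1n mul1e.
by apply: eq_integral => x _; rewrite scale1r.
Qed.

Let mkB : measurable_fun setT (fun p : 'rV[R]_n * 'rV[R]_n => k (p.1 - p.2)%R).
Proof. exact: (measurableT_comp mk (@measurable_sub_pair R n)). Qed.

Let m1A : measurable_fun setT (fun x : 'rV[R]_n => (\1_A x)%:E : \bar R).
Proof. by apply/measurable_EFinP; exact: measurable_indic. Qed.

Let vol : \int[mu]_y ((\1_A y)%:E * I) < +oo.
Proof.
have I0 : 0 <= I by exact: integral_ge0.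
have Ifin : I \is a fin_num by rewrite ge0_fin_numE.
rewrite ge0_integralZr//.
by rewrite integral_indic// setIT muleC lte_mul_pinfty.
Qed.

Definition restrict_fst (p : 'rV[R]_n * 'rV[R]_n) := (\1_A p.1)%:E * k (p.1 - p.2)%R.
Definition restrict_snd (p : 'rV[R]_n * 'rV[R]_n) := (\1_A p.2)%:E * k (p.1 - p.2)%R.

Lemma restrict_fst_ge0 p : 0 <= restrict_fst p.
Proof. by rewrite mule_ge0// lee_fin. Qed.

Lemma restrict_snd_ge0 p : 0 <= restrict_snd p.
Proof. by rewrite mule_ge0// lee_fin. Qed.

Lemma measurable_restrict_fst : measurable_fun setT restrict_fst.
Proof. by apply: emeasurable_funM => //; exact: (measurableT_comp m1A measurable_fst). Qed.

Lemma measurable_restrict_snd : measurable_fun setT restrict_snd.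
Proof. by apply: emeasurable_funM => //; exact: (measurableT_comp m1A measurable_snd). Qed.

Lemma integral_restrict_snd_lty : \int[mu]_y \int[mu]_x restrict_snd (x, y) < +oo.
Proof.
rewrite (eq_integral (fun y => (\1_A y)%:E * I)) => [|y _]; first exact: vol.
rewrite -(translate y) -ge0_integralZl// ?lee_fin//.
exact: (measurable_fun_pair1 y mkB).
Qed.

(** The variable confined to [A] is the inner one; Tonelli exchanges the order, and the symmetry of
    [k] gives a translate in y. *)
Lemma integral_restrict_fst_lty : \int[mu]_y \int[mu]_x restrict_fst (x, y) < +oo.
Proof.
rewrite -(fubini_tonelli (m1 := mu) (m2 := mu) restrict_fst
  measurable_restrict_fst restrict_fst_ge0).
rewrite (eq_integral (fun x => (\1_A x)%:E * I)) => [|x _]; first exact: vol.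
rewrite -(translate x) -ge0_integralZl// ?lee_fin//.
  by apply: eq_integral => y _; rewrite /restrict_fst/= -(ksym (y - x)) opprB.
exact: (measurable_fun_pair1 x mkB).
Qed.

End translation_kernel.

Section finiteness.
Context {R : realType}.
Variable n : nat.
Hypothesis n_gt0 : (0 < n)%N.
Local Notation mu := (@lebesgue_rV R n).
Variables (s q a : R).
Hypotheses (s01 : 0 < s < 1) (q_gt0 : 0 < q) (a_gt : - n%:R < a).

Let levy (z : 'rV[R]_n) : \bar R := (levy_density s z)%:E.

Let levy_ge0 z : (0 <= levy z)%E.
Proof. by rewrite lee_fin levy_density_ge0. Qed.

Let measurable_levy : measurable_fun setT levy.
Proof. by apply/measurable_EFinP; exact: measurable_levy_density. Qed.

Let levy_lty : (\int[mu]_z levy z < +oo)%E.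
Proof. exact: levy_density_lty. Qed.

Let B (M : R) := [set x : 'rV[R]_n | enorm x < M].

(** The kernel vanishes unless x or y lies in a ball carrying the support. The difference is at most
    twice the supremum and at most the Lipschitz constant times |x - y|, so its square is a multiple
    of the numerator of [levy_density]. *)
Let gagliardo_C0infty_bound (phi : 'rV[R]_n -> R) : C0infty phi ->
  exists M, exists2 c, 0 <= c & forall x y, (gagliardo_kernel s phi x y <=
    c%:E * (restrict_fst levy (B M) (x, y) + restrict_snd levy (B M) (x, y)))%E.
Proof.
move=> phiC; have [M M0 HM] := C0infty_support phiC.
have [L0 L00 HL0] := C0infty_bounded phiC.
have [L1 L10 HL1] := C0infty_lipschitz phiC.
have c0 : 0 <= (2 * L0) ^+ 2 + L1 ^+ 2 by rewrite addr_ge0 ?sqr_ge0.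
exists M, ((2 * L0) ^+ 2 + L1 ^+ 2) => // x y.
set c := _ + _ in c0 *.
have main : `|phi x - phi y| ^+ 2 <= c * Num.min 1 (enorm (x - y) ^+ 2).
  rewrite minr_pMr// le_min mulr1; apply/andP; split.
    apply: (@le_trans _ _ ((2 * L0) ^+ 2)); last by rewrite lerDl sqr_ge0.
    rewrite ler_pXn2r ?nnegrE ?mulr_ge0//.
    apply: le_trans (ler_normB _ _) _.
    by have := HL0 x; have := HL0 y; lra.
  apply: (@le_trans _ _ ((L1 * enorm (x - y)) ^+ 2)).
    by rewrite ler_pXn2r ?nnegrE ?mulr_ge0 ?enorm_ge0.
  by rewrite exprMn ler_wpM2r ?sqr_ge0// lerDr sqr_ge0.
rewrite /restrict_fst /restrict_snd /levy /= !indicE -!EFinM lee_fin.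
rewrite mulrDr /levy_density.
set m := Num.min _ _ in main *; set d := enorm _ `^ _.
have d0 : 0 <= d^-1 by rewrite invr_ge0 powR_ge0.
have cmd : 0 <= c * (m / d).
  by rewrite !mulr_ge0// /m le_min ler01 sqr_ge0.
have le1 : `|phi x - phi y| ^+ 2 / d <= c * (m / d).
  by rewrite mulrA ler_wpM2r.
have [phix|phix] := eqVneq (phi x) 0; last first.
  rewrite (mem_set (HM x phix : B M x)) mul1r.
  by apply: (le_trans le1); rewrite lerDl mulrCA mulr_ge0.
have [phiy|phiy] := eqVneq (phi y) 0; last first.
  rewrite (mem_set (HM y phiy : B M y)) mul1r.
  by apply: (le_trans le1); rewrite lerDr mulrCA mulr_ge0.
rewrite phix phiy subrr normr0 expr0n/= mul0r.
by rewrite addr_ge0// mulrCA mulr_ge0.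
Qed.

Lemma gagliardo_C0infty_lty (phi : 'rV[R]_n -> R) : C0infty phi ->
  (\int[mu]_y gagliardo_density s phi y < +oo)%E.
Proof.
move=> phiC; have [M [c c0 Hc]] := gagliardo_C0infty_bound phiC.
have mphi : measurable_fun setT phi.
  by apply: continuous_measurable_rV; exact: C0infty_continuous.
have mB : measurable (B M) by exact: measurable_ball_enorm.
have Boo : (mu (B M) < +oo)%E by exact: ball_lty.
have levyN z : levy (- z) = levy z by rewrite /levy /levy_density enormN.
pose h1 := restrict_fst levy (B M); pose h2 := restrict_snd levy (B M).
have h10 p : (0 <= h1 p)%E by exact: restrict_fst_ge0.
have h20 p : (0 <= h2 p)%E by exact: restrict_snd_ge0.
have mh1 : measurable_fun setT h1 by exact: measurable_restrict_fst.
have mh2 : measurable_fun setT h2 by exact: measurable_restrict_snd.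
have H1 : (\int[mu]_y \int[mu]_x h1 (x, y) < +oo)%E.
  exact: (integral_restrict_fst_lty measurable_levy levy_ge0 levyN levy_lty mB Boo).
have H2 : (\int[mu]_y \int[mu]_x h2 (x, y) < +oo)%E.
  exact: (integral_restrict_snd_lty measurable_levy levy_ge0 levy_lty mB Boo).
apply: (iterated_integral_dominated c0 (measurable_gagliardo_kernel s mphi)
  mh1 mh2 _ h10 h20 _ H1 H2) => [p|[x y]]; first exact: gagliardo_kernel_ge0.
exact: Hc.
Qed.

Lemma weighted_C0infty_lty (phi : 'rV[R]_n -> R) : C0infty phi ->
  (\int[mu]_x (`|phi x| `^ q * enorm x `^ a)%:E < +oo)%E.
Proof.
move=> phiC; have [M M0 HM] := C0infty_support phiC.
have [L0 L00 HL0] := C0infty_bounded phiC.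
have mphi : measurable_fun setT phi.
  by apply: continuous_measurable_rV; exact: C0infty_continuous.
have mB1 : measurable (B 1) by exact: measurable_ball_enorm.
(* The ball of radius [M] as a dilate of the unit ball, on which |x|^a is integrable since a >
   -n. *)
pose A := [set x | B 1 (M^-1 *: x)].
have mA : measurable A.
  rewrite -[X in measurable X]setTI.
  have := measurable_affine M^-1 (0 : 'rV[R]_n) => /(_ measurableT _ mB1).
  by under [X in _ `&` X]eq_set do rewrite addr0.
have Aoo : (\int[mu]_(x in A) (enorm x `^ a)%:E < +oo)%E.
  rewrite integral_enorm_powR_scale//.
  by rewrite lte_mul_pinfty ?lee_fin ?mulr_ge0 ?exprn_ge0 ?powR_ge0 ?(ltW M0)//;
    exact: ball_powR_lty.
apply: (@le_lt_trans _ _ (\int[mu]_x ((L0 `^ q)%:E *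
    ((fun x => (enorm x `^ a)%:E) \_ A) x))%E).
  have mr : measurable_fun setT ((fun x => (enorm x `^ a)%:E) \_ A).
    exact: ((measurable_restrictT _ mA).1 (measurable_funTS (measurable_enorm_powR a))).
  apply: ge0_le_integral => //.
  - by move=> x _; rewrite lee_fin mulr_ge0 ?powR_ge0.
  - exact: measurable_weighted.
  - exact: measurable_funeM.
  - move=> x _; rewrite patchE; case: ifPn => [_|xA].
      rewrite -EFinM lee_fin ler_wpM2r ?powR_ge0//.
      by apply: ge0_ler_powR; rewrite ?nnegrE ?(ltW q_gt0).
    have -> : phi x = 0.
      apply: contrapT => /eqP /HM xM; move: xA; rewrite notin_setE; apply.
      by rewrite /A /B /= enormZ gtr0_norm ?invr_gt0// mulrC ltr_pdivrMr// mul1r.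
    by rewrite normr0 powR0 ?gt_eqF// mul0r mule0.
rewrite ge0_integralZl_EFin ?powR_ge0//.
- by rewrite -integral_mkcond lte_mul_pinfty ?lee_fin ?powR_ge0.
- by move=> x _; apply: erestrict_ge0 => y _; rewrite lee_fin powR_ge0.
- exact: ((measurable_restrictT _ mA).1 (measurable_funTS (measurable_enorm_powR a))).
Qed.

Lemma gagliardo_lty_sub (u v : 'rV[R]_n -> R) :
  measurable_fun setT u -> measurable_fun setT v ->
  (\int[mu]_y gagliardo_density s (fun x => (u x - v x)%R) y < +oo)%E ->
  (\int[mu]_y gagliardo_density s v y < +oo)%E ->
  (\int[mu]_y gagliardo_density s u y < +oo)%E.
Proof.
move=> mu_ mv; set w := (fun x => (u x - v x)%R) => Hw Hv.
have mw : measurable_fun setT w by exact: measurable_funB.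
apply: (iterated_integral_dominated (c := 2) _ (measurable_gagliardo_kernel s mu_)
  (measurable_gagliardo_kernel s mw) (measurable_gagliardo_kernel s mv)
  _ _ _ _ Hw Hv) => // [p|p|p|[x y]]; try exact: gagliardo_kernel_ge0.
rewrite /gagliardo_kernel -EFinD -EFinM lee_fin -mulrDl mulrA.
rewrite ler_wpM2r ?invr_ge0 ?powR_ge0// !real_normK ?num_real// /w/=.
by have := sqr_ge0 (u x - v x - (u y - v y) - (v x - v y)); nra.
Qed.

Lemma weighted_lty_sub (u v : 'rV[R]_n -> R) :
  measurable_fun setT u -> measurable_fun setT v ->
  (\int[mu]_x (`|u x - v x| `^ q * enorm x `^ a)%:E < +oo)%E ->
  (\int[mu]_x (`|v x| `^ q * enorm x `^ a)%:E < +oo)%E ->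
  (\int[mu]_x (`|u x| `^ q * enorm x `^ a)%:E < +oo)%E.
Proof.
move=> mu_ mv Hw Hv.
have mw : measurable_fun setT (fun x => u x - v x) by exact: measurable_funB.
have h0 (z : 'rV[R]_n -> R) x : (0 <= (`|z x| `^ q * enorm x `^ a)%:E)%E.
  by rewrite lee_fin mulr_ge0 ?powR_ge0.
apply: (@le_lt_trans _ _ (\int[mu]_x ((2 `^ q)%:E * (
    (`|u x - v x| `^ q * enorm x `^ a)%:E + (`|v x| `^ q * enorm x `^ a)%:E)))%E).
  apply: ge0_le_integral => //.
  - exact: measurable_weighted.
  - apply: measurable_funeM; apply: emeasurable_funD; last exact: measurable_weighted.
    exact: (measurable_weighted _ _ mw).
  - move=> x _; rewrite -EFinD -EFinM lee_fin -mulrDl mulrA.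
    rewrite ler_wpM2r ?powR_ge0//.
    have key (c d : R) : 0 <= c -> c <= d -> (c + d) `^ q <= 2 `^ q * (c `^ q + d `^ q).
      move=> c0 cd; have d0 := le_trans c0 cd.
      apply: (@le_trans _ _ ((2 * d) `^ q)).
        by apply: ge0_ler_powR; rewrite ?nnegrE ?(ltW q_gt0)//; lra.
      by rewrite powRM// ler_wpM2l ?powR_ge0// lerDr powR_ge0.
    apply: (@le_trans _ _ ((`|u x - v x| + `|v x|) `^ q)).
      apply: ge0_ler_powR; rewrite ?nnegrE ?(ltW q_gt0) ?addr_ge0//.
      by apply: le_trans (ler_normD _ _); rewrite subrK.
    have [le|/ltW le] := leP `|u x - v x| `|v x|; first exact: key.
    by rewrite addrC [X in _ * X]addrC; exact: key.
have h0w x : (0 <= (`|u x - v x| `^ q * enorm x `^ a)%:E)%E := h0 (fun x => u x - v x) x.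
have mww := measurable_weighted q a mw; have mwv := measurable_weighted q a mv.
have mwD := emeasurable_funD mww mwv.
have h0D x : (0 <= (`|u x - v x| `^ q * enorm x `^ a)%:E + (`|v x| `^ q * enorm x `^ a)%:E)%E.
  by rewrite adde_ge0.
rewrite ge0_integralZl_EFin ?powR_ge0// ge0_integralD//.
by rewrite lte_mul_pinfty ?lee_fin ?powR_ge0//; exact: lte_add_pinfty.
Qed.

(** Convergence to 0 makes the norm of u - phi_N finite for some N; a test function has finite
    integrals, and finiteness passes to the sum. *)
Lemma Hspace_lty (u : 'rV[R]_n -> R) : Hspace s q a u ->
  (\int[mu]_y gagliardo_density s u y < +oo)%E /\
  (\int[mu]_x (`|u x| `^ q * enorm x `^ a)%:E < +oo)%E.
Proof.
move=> [mu_ [phi [phiC /fine_cvgP[+ _]]]].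
move=> [N _ /(_ N (leqnn N))].
set v := phi N; set w := (fun x => u x - v x).
have vC : C0infty v by exact: phiC.
have mv : measurable_fun setT v.
  by apply: continuous_measurable_rV; exact: C0infty_continuous.
rewrite ge0_fin_numE ?poweR_ge0// => /lty_poweRy => /(_ _).
rewrite invr_eq0 pnatr_eq0 => /(_ isT) Hlt.
have yy : (+oo ^+ 2 = +oo :> \bar R)%E by rewrite expe2 mulyy.
have sq0 (x : \bar R) : (0 <= x -> 0 <= x ^+ 2)%E by move=> x0; rewrite expe2 mule_ge0.
have gw : (gagliardo s w < +oo)%E.
  rewrite ltey; apply: contraTneq Hlt => E.
  by rewrite E yy addye ?ltxx// gt_eqF// (lt_le_trans _ (sq0 _ (poweR_ge0 _ _))) ?ltNy0.
have ww : (wLnorm q a w < +oo)%E.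
  rewrite ltey; apply: contraTneq Hlt => E.
  by rewrite E yy addey ?ltxx// gt_eqF// (lt_le_trans _ (sq0 _ (poweR_ge0 _ _))) ?ltNy0.
split.
  apply: (gagliardo_lty_sub mu_ mv); last exact: gagliardo_C0infty_lty.
  move: gw => /lty_poweRy => /(_ _); rewrite invr_eq0 pnatr_eq0 => /(_ isT).
  rewrite -[X in (_ * X < _)%E -> _]/(\int[mu]_y gagliardo_density s w y)%E.
  move=> h; rewrite ltey; apply: contraTneq h => ->.
  (* A vanishing constant would hide an infinite double integral, since 0 times infinity is 0. *)
  by rewrite gt0_muley ?ltxx// lte_fin divr_gt0// fracC_gt0.
apply: (weighted_lty_sub mu_ mv); last exact: weighted_C0infty_lty.
by move: ww => /lty_poweRy; apply; rewrite invr_eq0 gt_eqF.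
Qed.

End finiteness.

(** * Invariance under equality almost everywhere, continuity, and the conclusion *)

Section ae_invariance.
Context {R : realType}.
Variable n : nat.
Local Notation mu := (@lebesgue_rV R n).
Variables u v : 'rV[R]_n -> R.
Hypotheses (mu_ : measurable_fun setT u) (mv : measurable_fun setT v).
Hypothesis uv : {ae mu, forall x, u x = v x}.

Lemma integral_gagliardo_density_ae (s : R) :
  (\int[mu]_y gagliardo_density s u y = \int[mu]_y gagliardo_density s v y)%E.
Proof.
apply: ge0_ae_eq_integral => //.
- exact: measurable_gagliardo_density.
- exact: measurable_gagliardo_density.
- by move=> y _; exact: gagliardo_density_ge0.
- by move=> y _; exact: gagliardo_density_ge0.
apply: filterS uv => y uvy _; apply: ge0_ae_eq_integral => //.
- exact: measurable_gagliardo_kernelx.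
- exact: measurable_gagliardo_kernelx.
- by move=> x _; exact: gagliardo_kernel_ge0.
- by move=> x _; exact: gagliardo_kernel_ge0.
by apply: filterS uv => x uvx _; rewrite /gagliardo_kernel uvx uvy.
Qed.

Lemma integral_weighted_ae (q a : R) :
  (\int[mu]_x (`|u x| `^ q * enorm x `^ a)%:E =
   \int[mu]_x (`|v x| `^ q * enorm x `^ a)%:E)%E.
Proof.
apply: ge0_ae_eq_integral => //.
- exact: measurable_weighted.
- exact: measurable_weighted.
- by move=> x _; rewrite lee_fin mulr_ge0 ?powR_ge0.
- by move=> x _; rewrite lee_fin mulr_ge0 ?powR_ge0.
by apply: filterS uv => x uvx _; rewrite uvx.
Qed.

End ae_invariance.

Section continuity.
Context {R : realType}.

Lemma hoelder_continuous (w B : R -> R) (alpha : R) : 0 < alpha ->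
  (forall r r', 0 < r -> r <= r' -> B r' <= B r) ->
  (forall r r', 0 < r -> r < r' -> `|w r - w r'| <= B r * (r' - r) `^ alpha) ->
  forall r, 0 < r -> {for r, continuous w}.
Proof.
move=> a0 Bmono wB r r0; apply/cvgrPdist_lt => e e0.
(* The Hoelder constant at r/2 serves for all larger radii, and d <= r/2 keeps the points there. *)
pose M := `|B (r / 2)| + 1.
have M0 : 0 < M by rewrite ltr_wpDl.
pose d := Num.min (r / 2) ((e / M) `^ alpha^-1).
have d0 : 0 < d by rewrite lt_min divr_gt0//= powR_gt0// divr_gt0.
have small t : 0 <= t -> t < d -> M * t `^ alpha < e.
  move=> t0 td; rewrite mulrC -ltr_pdivlMr//.
  have -> : e / M = ((e / M) `^ alpha^-1) `^ alpha.
    by rewrite -powRrM mulVf ?gt_eqF// powRr1// divr_ge0 ?ltW.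
  apply: gt0_ltr_powR; rewrite ?nnegrE ?powR_ge0//.
  by apply: (lt_le_trans td); rewrite ge_min lexx orbT.
have gen x y : r / 2 <= x -> x < y -> y - x < d -> `|w x - w y| < e.
  move=> rx xy xyd; apply: le_lt_trans (small (y - x) _ xyd); last by lra.
  apply: (le_trans (wB x y _ xy)); first by lra.
  rewrite ler_wpM2r ?powR_ge0//.
  apply: (@le_trans _ _ (B (r / 2))); first by apply: Bmono => //; lra.
  by rewrite /M (le_trans (ler_norm _))// lerDl.
have : nbhs r (ball r d) by exact: nbhsx_ballx.
apply: filterS => t; rewrite /ball/= => rt.
have dr : d <= r / 2 by rewrite ge_min lexx.
move: rt; rewrite ltr_norml => /andP[rt1 rt2].
have [rt|tr|<-] := ltgtP r t.
- by apply: gen => //; lra.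
- by rewrite distrC; apply: gen => //; lra.
- by rewrite subrr normr0.
Qed.

End continuity.

Theorem theorem3p1 (R : realType) (n : nat) (s q a : R) (hn : (0 < n)%N)
    (hs : 1 / 2 < s < 1) (hq : 1 < q)
    (ha : - (n%:R - 1) <= a < n%:R * (q - 1)) :
  [/\ 0 < theta s q < 1,
      sigma n s q a = (2 * a * s + 2 * n%:R * s - a - 2 * s) /
                      (2 * q * s - q + 2)
    & exists C C' : R, forall u : 'rV[R]_n -> R, Hspace_rad s q a u ->
      exists v : 'rV[R]_n -> R,
        [/\ {ae lebesgue_rV n, forall x, u x = v x},
            {within [set x | x != 0], continuous v},
            forall x, x != 0 ->
              ((`|v x|)%:E <= (C * enorm x `^ (- sigma n s q a))%:E
                 * gagliardo s u `^ theta s q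
                 * wLnorm q a u `^ (1 - theta s q))%E
          & forall x, x != 0 ->
              ((`|v x|)%:E <= (C' * enorm x `^ (- sigma n s q a))%:E
                 * Hnorm s q a u)%E]].
Proof.
case/andP: hs => s_gt s_lt1; case/andP: ha => a_ge a_lt.
have s01 : 0 < s < 1 by apply/andP; split; lra.
have q_gt0 : 0 < q by lra.
have a_gt : - n%:R < a by lra.
have [th01 _ _] := theta_sigma s_gt hq.
have /andP[th0 th1] := th01.
have den : 0 < 2 * s * q + 2 - q by nra.
split => //.
  rewrite /sigma /theta; field; rewrite !gt_eqF//=.
  by rewrite (_ : 2 * q * s - q + 2 = 2 * s * q + 2 - q)//; ring.
have c_gt0 := fracC_gt0 hn s01; set c := fracC n s in c_gt0.
(* [u] is [k] times the root of the double integral; the power k^(-theta) in [C] compensates for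
   this. *)
pose k := (c / 2) `^ 2^-1.
have k0 : 0 < k by rewrite powR_gt0// divr_gt0.
pose C := strauss_const n s q * k `^ (- theta s q).
have C0 : 0 <= C.
  by rewrite !mulr_ge0 ?powR_ge0.
exists C, C => u [uH urad].
have [Doo Woo] := Hspace_lty hn s01 q_gt0 a_gt uH.
have mu_ : measurable_fun setT u by case: uH.
have [f [mf uf]] := radial_measurable_profile hn mu_ urad.
have mU : measurable_fun setT (fun x : 'rV[R]_n => f (enorm x)).
  exact: (measurableT_comp mf (@measurable_enorm R n)).
have D0 : (0 <= \int[lebesgue_rV n]_y gagliardo_density s u y)%E.
  by apply: integral_ge0 => y _; exact: gagliardo_density_ge0.
have W0 : (0 <= \int[lebesgue_rV n]_x (`|u x| `^ q * enorm x `^ a)%:E)%E.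
  by apply: integral_ge0 => x _; rewrite lee_fin mulr_ge0 ?powR_ge0.
have [D DE] : exists D, (\int[lebesgue_rV n]_y gagliardo_density s u y = D%:E)%E.
  by exists (fine (\int[lebesgue_rV n]_y gagliardo_density s u y)%E); rewrite fineK// ge0_fin_numE.
have [W WE] : exists W,
    (\int[lebesgue_rV n]_x (`|u x| `^ q * enorm x `^ a)%:E = W%:E)%E.
  exists (fine (\int[lebesgue_rV n]_x (`|u x| `^ q * enorm x `^ a)%:E)%E).
  by rewrite fineK// ge0_fin_numE.
rewrite DE lee_fin in D0; rewrite WE lee_fin in W0.
have DfE := etrans (esym (integral_gagliardo_density_ae mu_ mU uf s)) DE.
have WfE := etrans (esym (integral_weighted_ae mu_ mU uf q a)) WE.
have [w [wh fw wbound]] := strauss_profile hn s_gt hq a_ge mf DfE WfE.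
have gE : gagliardo s u = (k * Num.sqrt D)%:E.
  rewrite /gagliardo -[X in ((_ * X) `^ _)%E]/(\int[lebesgue_rV n]_y gagliardo_density s u y)%E.
  rewrite DE -EFinM poweR_EFin powRM ?divr_ge0 ?(ltW c_gt0)//.
  by rewrite (powR12_sqrt D0).
have lE : wLnorm q a u = (W `^ q^-1)%:E by rewrite /wLnorm WE poweR_EFin.
pose g := k * Num.sqrt D; pose l := W `^ q^-1.
have g0 : 0 <= g by rewrite mulr_ge0 ?sqrtr_ge0 ?(ltW k0).
have l0 : 0 <= l by exact: powR_ge0.
have bound (x : 'rV[R]_n) : x != 0 -> `|w (enorm x)| <=
    C * enorm x `^ (- sigma n s q a) * (g `^ theta s q * l `^ (1 - theta s q)).
  rewrite -enorm_gt0 => x0; apply: (le_trans (wbound _ x0)).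
  rewrite /C /g powRM ?sqrtr_ge0 ?(ltW k0)// (powRN k).
  rewrite -/l le_eqVlt; apply/orP; left; apply/eqP.
  have kth : k `^ theta s q != 0 by rewrite gt_eqF// powR_gt0.
  move: (strauss_const _ _ _) (enorm x `^ _) (Num.sqrt D `^ _) (l `^ _) (k `^ _) kth.
  by move=> x1 x2 x3 x4 x5 x50; field.
exists (fun x => w (enorm x)); split.
- by apply: filterS2 uf fw => x -> ->.
- apply: continuous_in_subspaceT => x; rewrite inE/= -enorm_gt0 => x0.
  apply: continuous_comp; first exact: continuous_enorm.
  apply: (hoelder_continuous (B := fun r => morrey_const n s * Num.sqrt (D / r ^+ n.-1))
    _ _ wh x0).
    by rewrite subr_gt0.
  move=> r r' r0 rr'; rewrite ler_wpM2l ?morrey_const_ge0// ler_wsqrtr// ler_wpM2l//.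
  rewrite lef_pV2 ?posrE ?exprn_gt0//; last exact: lt_le_trans rr'.
  by rewrite lerXn2r ?nnegrE ?(ltW r0) ?(le_trans (ltW r0) rr').
- move=> x x0; rewrite gE lE !poweR_EFin -!EFinM lee_fin -mulrA; exact: bound.
- move=> x x0; have -> : Hnorm s q a u = ((g * g + l * l) `^ 2^-1)%:E.
    by rewrite /Hnorm gE lE !expe2.
  rewrite -EFinM lee_fin.
  apply: (le_trans (bound x x0)); rewrite ler_wpM2l ?mulr_ge0 ?powR_ge0//.
  rewrite powR12_sqrt; last by apply: addr_ge0; exact: mulr_ge0.
  set h := Num.sqrt _; have h0 : 0 <= h by exact: sqrtr_ge0.
  have gh : g <= h by rewrite -(ger0_norm g0) -sqrtr_sqr ler_wsqrtr// lerDl mulr_ge0.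
  have lh : l <= h by rewrite -(ger0_norm l0) -sqrtr_sqr ler_wsqrtr// lerDr mulr_ge0.
  (* Both g and l are at most h and the two exponents sum to 1, so the same constant serves. *)
  have -> : h = h `^ theta s q * h `^ (1 - theta s q).
    by rewrite -powRD subrKC ?powRr1// oner_eq0.
  by apply: ler_pM; rewrite ?powR_ge0//; apply: ge0_ler_powR;
    rewrite ?nnegrE ?subr_ge0 ?(ltW th0) ?(ltW th1).
Qed.
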